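(* Let $Q\subset\mathbb{R}^n$ be a lattice smooth polytope. The following properties are equivalent: 1. For every lattice smooth bundle $P$ with fiber $Q$ and base $[-1,1]$, we have $\mathcal{E}(P)\not\subset\{0\}\times Q$, where $\{0\}\times Q$ denotes the fiber $i(Q)=\pi^{-1}(0)\cap P$. 2. $Q$ is neat. 3. For every lattice smooth bundle $P$ with fiber $Q$ and an arbitrary base $B$, every point of $\mathcal{E}(B)$ can be lifted to a point in $\mathcal{E}(P)$ (i.e. for every $v\in\mathcal{E}(B)$ there is $z\in\mathcal{E}(P)$ with $\pi(z)=v$).
   Context: The Ewald set of a polytope $P\subset\mathbb{R}^n$ is $\mathcal{E}(P):=\mathbb{Z}^n\cap P\cap(-P)$. An $n$-dimensional polytope in $\mathbb{R}^n$ is smooth if it is simple, rational, and the primitive edge-direction vectors at each vertex form a basis of $\mathbb{Z}^n$; lattice smooth means smooth with vertices in $\mathbb{Z}^n$. Two polytopes are normally isomorphic if they have the same normal fan. $P\subset\mathbb{R}^{k+n}$ is a bundle with base $B\subset\mathbb{R}^k$ and fiber $Q\subset\mathbb{R}^n$ if (i) $P$ is combinatorially equivalent to $B\times Q$, and (ii) there is a short exact sequence of linear maps $0\to\mathbb{R}^n\xrightarrow{i}\mathbb{R}^{k+n}\xrightarrow{\pi}\mathbb{R}^k\to0$ such that $\pi(P)=B$ and for every $x\in B$ the polytope $\pi^{-1}(x)\cap P$ is normally isomorphic to $i(Q)$. Conventions: all bundles are unimodular, i.e. $i$ and $\pi$ become, after unimodular changes of coordinates, the standard inclusion and projection with respect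 to the integer lattices; and if $0\in B$, then $i(Q)=\pi^{-1}(0)\cap P$. Neat: let $Q=\{x\in\mathbb{R}^n: Ax\le c\}$ be the irredundant facet description of a smooth lattice polytope, with $A\in\mathbb{Z}^{m\times n}$ having primitive rows and $c\in\mathbb{Z}^m$. For $b\in\mathbb{Z}^m$ put $Q_b:=\{x\in\mathbb{R}^n:Ax\le c+b\}$. $Q$ is neat if for every $b\in\mathbb{Z}^m$ such that both $Q_b$ and $Q_{-b}$ are normally isomorphic to $Q$, one has $Q_b\cap(-Q_{-b})\cap\mathbb{Z}^n\neq\varnothing$. *)

(* Defs.v *)
From HB Require Import structures.
From mathcomp Require Import all_boot all_order all_algebra.
From mathcomp Require Import boolp classical_sets functions cardinality reals.

Set Implicit Arguments.
Unset Strict Implicit.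
Unset Printing Implicit Defensive.
Import Order.TTheory GRing.Theory Num.Theory.
Local Open Scope classical_set_scope.
Local Open Scope ring_scope.

(* Points of R^n are column vectors; a polytope is represented by its set of
   points. *)

Definition zmx (R : realType) (m n : nat) (A : 'M[int]_(m, n)) : 'M[R]_(m, n) :=
  map_mx intr A.

Definition lattice (R : realType) (n : nat) : set 'cV[R]_n :=
  [set x | exists z : 'cV[int]_n, x = zmx R z].

Definition primitive (n : nat) (u : 'cV[int]_n) : Prop :=
  \big[gcdn/0%N]_(i < n) absz (u i 0) = 1%N.

Definition dot (R : realType) (n : nat) (u x : 'cV[R]_n) : R :=
  \sum_(i < n) u i 0 * x i 0.

Definition polyhedron (R : realType) (m n : nat)
    (A : 'M[R]_(m, n)) (c : 'cV[R]_m) : set 'cV[R]_n :=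
  [set x | forall i, (A *m x) i 0 <= c i 0].

Definition polytope (R : realType) (n : nat) (P : set 'cV[R]_n) : Prop :=
  (exists (m : nat) (A : 'M[R]_(m, n)) (c : 'cV[R]_m), P = polyhedron A c) /\
  (exists M : R, forall x, P x -> forall i, `|x i 0| <= M).

(* [S] has affine dimension [d]: x0 and the points x0 + col j D are d + 1
   affinely independent points of S, and S lies in their affine hull. *)
Definition has_dim (R : realType) (n : nat) (S : set 'cV[R]_n) (d : nat) : Prop :=
  exists (x0 : 'cV[R]_n) (D : 'M[R]_(n, d)),
    [/\ S x0, forall j, S (x0 + col j D), \rank D = d
      & forall x, S x -> exists w : 'cV[R]_d, x = x0 + D *m w].

Definition face (R : realType) (n : nat) (P : set 'cV[R]_n) (u : 'cV[R]_n) :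
    set 'cV[R]_n :=
  [set x | P x /\ forall y, P y -> dot u y <= dot u x].

(* All faces, including the empty one and (for u = 0) P itself. *)
Definition faces (R : realType) (n : nat) (P : set 'cV[R]_n) :
    set (set 'cV[R]_n) :=
  [set F | F = set0 \/ exists u, F = face P u].

Definition vertex (R : realType) (n : nat) (P : set 'cV[R]_n) (v : 'cV[R]_n) :
  Prop := faces P [set v].

Definition edge (R : realType) (n : nat) (P F : set 'cV[R]_n) : Prop :=
  faces P F /\ has_dim F 1.

Definition normal_cone (R : realType) (n : nat) (P F : set 'cV[R]_n) :
    set 'cV[R]_n :=
  [set u | F `<=` face P u].

Definition normal_fan (R : realType) (n : nat) (P : set 'cV[R]_n) :
    set (set 'cV[R]_n) :=
  [set N | exists F, [/\ faces P F, F !=set0 & N = normal_cone P F]].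

Definition normally_isomorphic (R : realType) (n : nat) (P Q : set 'cV[R]_n) :
  Prop := normal_fan P = normal_fan Q.

Definition comb_equiv (R : realType) (n m : nat)
    (P : set 'cV[R]_n) (Q : set 'cV[R]_m) : Prop :=
  exists f : set 'cV[R]_n -> set 'cV[R]_m,
    set_bij (faces P) (faces Q) f /\
    forall F G, faces P F -> faces P G -> (F `<=` G <-> f F `<=` f G).

Definition simple_polytope (R : realType) (n : nat) (P : set 'cV[R]_n) : Prop :=
  forall v, vertex P v -> ([set F | edge P F /\ F v] #= `I_n)%card.

Definition rational_polytope (R : realType) (n : nat) (P : set 'cV[R]_n) : Prop :=
  forall F, edge P F ->
    exists2 u : 'cV[int]_n, u != 0 &
      forall x y, F x -> F y -> exists t : R, y - x = t *: zmx R u.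

Definition primitive_edge_direction (R : realType) (n : nat)
    (P : set 'cV[R]_n) (v : 'cV[R]_n) (u : 'cV[int]_n) : Prop :=
  primitive u /\
  exists F, [/\ edge P F, F v & exists2 t : R, 0 < t & F (v + t *: zmx R u)].

(* The columns of an integer matrix that is invertible over the integers are
   exactly the bases of Z^n. *)
Definition smooth (R : realType) (n : nat) (P : set 'cV[R]_n) : Prop :=
  [/\ polytope P, has_dim P n, simple_polytope P, rational_polytope P
    & forall v, vertex P v ->
        exists2 M : 'M[int]_n, M \in unitmx &
          forall u, primitive_edge_direction P v u <-> exists j, u = col j M].

Definition lattice_smooth (R : realType) (n : nat) (P : set 'cV[R]_n) : Prop :=
  smooth P /\ forall v, vertex P v -> lattice v.

Definition ewald (R : realType) (n : nat) (P : set 'cV[R]_n) : set 'cV[R]_n :=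
  [set x | [/\ lattice x, P x & P (- x)]].

Definition prod_set (R : realType) (k n : nat)
    (B : set 'cV[R]_k) (Q : set 'cV[R]_n) : set 'cV[R]_(k + n) :=
  [set col_mx x y | x in B & y in Q].

Definition short_exact (R : realType) (k n : nat)
    (i : {linear 'cV[R]_n -> 'cV[R]_(k + n)})
    (p : {linear 'cV[R]_(k + n) -> 'cV[R]_k}) : Prop :=
  [/\ injective i, (forall x, exists z, p z = x)
    & forall z, p z = 0 <-> exists y, z = i y].

(* U, V, W are the coordinate changes of Z^n, Z^(k + n), Z^k, turning i into
   y |-> (0, y) and p into (x, y) |-> x. *)
Definition unimodular_sequence (R : realType) (k n : nat)
    (i : {linear 'cV[R]_n -> 'cV[R]_(k + n)})
    (p : {linear 'cV[R]_(k + n) -> 'cV[R]_k}) : Prop :=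
  exists (U : 'M[int]_n) (V : 'M[int]_(k + n)) (W : 'M[int]_k),
    [/\ [/\ U \in unitmx, V \in unitmx & W \in unitmx],
        (forall y, zmx R V *m i y = col_mx 0 (zmx R U *m y))
      & (forall z, zmx R W *m p z = usubmx (zmx R V *m z))].

Record bundle (R : realType) (k n : nat)
    (P : set 'cV[R]_(k + n)) (B : set 'cV[R]_k) (Q : set 'cV[R]_n)
    (i : {linear 'cV[R]_n -> 'cV[R]_(k + n)})
    (p : {linear 'cV[R]_(k + n) -> 'cV[R]_k}) : Prop := Bundle {
  bundle_total : polytope P;
  bundle_base : polytope B;
  bundle_fiber : polytope Q;
  bundle_comb : comb_equiv P (prod_set B Q);
  bundle_exact : short_exact i p;
  bundle_unimodular : unimodular_sequence i p;
  bundle_image : p @` P = B;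
  bundle_fibers : forall x, B x ->
    normally_isomorphic (p @^-1` [set x] `&` P) (i @` Q);
  bundle_zero : B 0 -> i @` Q = p @^-1` [set 0] `&` P }.

Definition segment11 (R : realType) : set 'cV[R]_1 :=
  [set x : 'cV[R]_1 | -1 <= x 0 0 <= 1].
Arguments segment11 R _ : clear implicits.

Definition irredundant (R : realType) (m n : nat)
    (A : 'M[R]_(m, n)) (c : 'cV[R]_m) : Prop :=
  forall i, exists x : 'cV[R]_n,
    (forall j, j != i -> (A *m x) j 0 <= c j 0) /\ c i 0 < (A *m x) i 0.

Definition facet_description (R : realType) (m n : nat) (Q : set 'cV[R]_n)
    (A : 'M[int]_(m, n)) (c : 'cV[int]_m) : Prop :=
  [/\ Q = polyhedron (zmx R A) (zmx R c),
      irredundant (zmx R A) (zmx R c)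
    & forall i, primitive (row i A)^T].

(* For a lattice smooth polytope the description (A, c) exists and is unique
   up to the order of the rows. *)
Definition neat (R : realType) (n : nat) (Q : set 'cV[R]_n) : Prop :=
  exists (m : nat) (A : 'M[int]_(m, n)) (c : 'cV[int]_m),
    facet_description Q A c /\
    let Q_ (b : 'cV[int]_m) := polyhedron (zmx R A) (zmx R (c + b)) in
    forall b : 'cV[int]_m,
      normally_isomorphic (Q_ b) Q -> normally_isomorphic (Q_ (- b)) Q ->
      exists x : 'cV[R]_n, [/\ Q_ b x, Q_ (- b) (- x) & lattice x].

(* Main.v *)
Require Import Defs.
From HB Require Import structures.
From mathcomp Require Import all_boot all_order all_algebra.
From mathcomp Require Import boolp classical_sets functions cardinality reals.
From mathcomp Require Import ring lra.

Set Implicit Arguments.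
Unset Strict Implicit.
Unset Printing Implicit Defensive.
Import Order.TTheory GRing.Theory Num.Theory.
Local Open Scope classical_set_scope.
Local Open Scope ring_scope.

(** A lattice smooth polytope is recognised vertex by vertex: at a lattice
    vertex v it lies in the cone v + M (R_+)^n, with M an integral unimodular
    matrix whose columns point along its edges ([corner], [lattice_smoothP]).
    Normal isomorphism only compares the maximal normal cones, those of the
    vertices ([normally_isomorphicP]).  These two translations remove edges,
    dimensions and fans from the argument.

    A neat fibre lifts Ewald points.  In suitable lattice coordinates i and p
    are the standard inclusion and projection ([bundle_coordinates]).  Each
    vertex of B carries a fibre with as many vertices as Q, all of them vertices
    of P; the combinatorial type leaves room for no others, so every vertex of
    P lies above a vertex of B ([vertices_over_base]).  Simplicity then makes
    the support function x |-> max of r over the fibre P_x affine with integral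
    coefficients, for each integral r ([affine_support]): near a vertex w it is
    given by the functional (lam, r) that vanishes on the edges of P leaving the
    fibre, this functional is the same at all vertices of the face F that it
    exposes, and so F cannot stop before it covers B.  Taking for r the rows of
    A shows that P_x = { y | A y <= c + L x } with L integral.  For v in E(B)
    and b = L v the fibres over v and - v are Q_b and Q_(-b), and the lattice
    point y provided by neatness gives the lift (v, y) ([neat_lift]).

    Lifting implies escaping: lift the point 1 of [-1, 1].

    Escaping implies neatness.  For b as in the definition of neatness, consider
    the prism of the pairs (t, y) with |t| <= 1 and A y <= c + t b.  No
    inequality of Q_b or Q_(-b) is slack, since otherwise a facet normal would
    be lost, and therefore the vertices of the layer at height t are v + t e_v
    with e_v integral and with edge directions independent of t
    ([moving_corner]).  So the prism is lattice smooth
    ([prism_lattice_smooth]).  Its faces match those of [-1, 1] x Q through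
    (mu, u) |-> (mu + <u, e_v>, u), where u is in the normal cone of v
    ([prism_comb_equiv]), and it is a bundle ([prism_bundle]).  A point of its
    Ewald set off the middle fibre has height 1 or -1, which is exactly a
    lattice point of Q_b opposite to one of Q_(-b) ([escape_neat]). *)

(** * Linear functionals in coordinates *)

Section Dot.
Variables (R : realType) (n : nat).
Implicit Types u x y : 'cV[R]_n.

Lemma dotE u x : dot u x = (u^T *m x) 0 0.
Proof. by rewrite mxE; apply: eq_bigr => i _; rewrite mxE. Qed.

Lemma dotDr u x y : dot u (x + y) = dot u x + dot u y.
Proof. by rewrite !dotE mulmxDr mxE. Qed.

Lemma dotBr u x y : dot u (x - y) = dot u x - dot u y.
Proof. by rewrite !dotE mulmxBr !mxE. Qed.

Lemma dotZr a u x : dot u (a *: x) = a * dot u x.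
Proof. by rewrite !dotE -scalemxAr mxE. Qed.

Lemma dotNr u x : dot u (- x) = - dot u x.
Proof. by rewrite !dotE mulmxN mxE. Qed.

Lemma dot0r u : dot u 0 = 0.
Proof. by rewrite dotE mulmx0 mxE. Qed.

Lemma dotC u x : dot u x = dot x u.
Proof. by apply: eq_bigr => i _; rewrite mulrC. Qed.

Lemma dotDl u x y : dot (x + y) u = dot x u + dot y u.
Proof. by rewrite -!(dotC u) dotDr. Qed.

Lemma dotNl u x : dot (- x) u = - dot x u.
Proof. by rewrite -!(dotC u) dotNr. Qed.

Lemma dotZl a u x : dot (a *: x) u = a * dot x u.
Proof. by rewrite -!(dotC u) dotZr. Qed.

Lemma dot_sumr u (I : finType) (C : pred I) (F : I -> 'cV[R]_n) :
  dot u (\sum_(i | C i) F i) = \sum_(i | C i) dot u (F i).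
Proof.
by rewrite dotE mulmx_sumr summxE; apply: eq_bigr => i _; rewrite dotE.
Qed.

Lemma dot_row m (A : 'M[R]_(m, n)) i x : (A *m x) i 0 = dot (row i A)^T x.
Proof. by rewrite dotE trmxK -row_mul [RHS]mxE. Qed.

Lemma dot_delta x i : dot (delta_mx i 0) x = x i 0.
Proof. by rewrite dotE trmx_delta -rowE [LHS]mxE. Qed.

Lemma dot_mulmx_col m (A : 'M[R]_(n, m)) u (x : 'cV[R]_m) :
  dot u (A *m x) = \sum_j dot u (col j A) * x j 0.
Proof.
rewrite dotE mulmxA mxE; apply: eq_bigr => j _; congr (_ * _).
by rewrite dotE colE mulmxA -colE [RHS]mxE.
Qed.

End Dot.

Lemma dot_mulmx (R : realType) n m (A : 'M[R]_(n, m)) u (x : 'cV[R]_m) :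
  dot u (A *m x) = dot (A^T *m u) x.
Proof. by rewrite !dotE trmx_mul trmxK mulmxA. Qed.

Lemma dot_col_mx (R : realType) k n (u1 x1 : 'cV[R]_k) (u2 x2 : 'cV[R]_n) :
  dot (col_mx u1 u2) (col_mx x1 x2) = dot u1 x1 + dot u2 x2.
Proof. by rewrite !dotE tr_col_mx mul_row_col mxE. Qed.

Section MulmxEntries.
Variables (R : realType) (m n : nat) (A : 'M[R]_(m, n)).
Implicit Types x y : 'cV[R]_n.

Lemma mulmxDE x y i : (A *m (x + y)) i 0 = (A *m x) i 0 + (A *m y) i 0.
Proof. by rewrite mulmxDr mxE. Qed.

Lemma mulmxBE x y i : (A *m (x - y)) i 0 = (A *m x) i 0 - (A *m y) i 0.
Proof. by rewrite mulmxBr mxE [X in _ + X]mxE. Qed.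

Lemma mulmxZE a x i : (A *m (a *: x)) i 0 = a * (A *m x) i 0.
Proof. by rewrite -scalemxAr mxE. Qed.

End MulmxEntries.

(** * Convex sets and active constraints *)

Section Convex.
Variable R : realType.

Definition convex n (C : set 'cV[R]_n) : Prop :=
  forall x y t, C x -> C y -> 0 < t < 1 -> C ((1 - t) *: x + t *: y).

Lemma polyhedron_convex m n (A : 'M[R]_(m, n)) c : convex (polyhedron A c).
Proof.
move=> x y t Px Py t01 i; have := Px i; have := Py i.
rewrite mulmxDr -!scalemxAr !mxE; nra.
Qed.

Lemma polytope_convex n (P : set 'cV[R]_n) : polytope P -> convex P.
Proof. by case=> -[m [A [c ->]]] _; apply: polyhedron_convex. Qed.

Lemma face_convex n (P : set 'cV[R]_n) u : convex P -> convex (face P u).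
Proof.
move=> cP x y t [Px hx] [Py hy] t01; split; first exact: cP.
move=> z Pz; have := hx z Pz; have := hy z Pz.
rewrite dotDr !dotZr; nra.
Qed.

End Convex.

Section Active.
Variables (R : realType).

Lemma sum_tight (I : finType) (J : pred I) (f g : I -> R) :
    (forall i, J i -> f i <= g i) ->
    \sum_(i | J i) g i <= \sum_(i | J i) f i ->
  forall i, J i -> f i = g i.
Proof.
move=> le_fg le_gf i Ji; apply/eqP; rewrite eq_sym -subr_eq0.
have : \sum_(i | J i) (g i - f i) == 0.
  by rewrite sumrB subr_eq0 eq_le le_gf ler_sum.
rewrite psumr_eq0 => [/allP/(_ i (mem_index_enum _))|j Jj].
  by rewrite Ji.
by rewrite subr_ge0 le_fg.
Qed.

Lemma dot_sum_rows m n (A : 'M[R]_(m, n)) (J : pred 'I_m) x :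
  dot (\sum_(i | J i) (row i A)^T) x = \sum_(i | J i) (A *m x) i 0.
Proof. by rewrite dotC dot_sumr; apply: eq_bigr => i _; rewrite dotC -dot_row.
Qed.

(** A common step length exists because only finitely many strict inequalities
    have to be preserved; the others must point in the right direction. *)
Lemma small_step (I : finType) (a e : I -> R) :
    (forall i, 0 <= a i) -> (forall i, a i = 0 -> e i <= 0) ->
  exists2 t : R, 0 < t & forall i, t * e i <= a i.
Proof.
move=> a0 ae.
pose f i := if a i == 0 then 1 else a i / (`|e i| + 1).
have f0 i : 0 < f i.
  rewrite /f; case: eqP => // /eqP ai; rewrite divr_gt0 //.
    by rewrite lt_def ai a0.
  by rewrite ltr_wpDl.
have [t t0 tf] : exists2 t : R, 0 < t & forall i, t <= f i.
  exists (\big[Num.min/1]_i f i).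
    by elim/big_ind: _ => // x y x0 y0; rewrite lt_min x0.
  by move=> i; rewrite (bigD1 i) //= ge_min lexx.
exists t => // i; have := tf i; rewrite /f; case: eqP => [ai _|ai].
  have := ae i ai; rewrite ai; nra.
have := a0 i; rewrite ler_pdivlMr ?ltr_wpDl // => ai0.
by apply: le_trans; rewrite ler_wpM2l ?ltW //; have := ler_norm (e i); lra.
Qed.

Lemma polyhedron_step m n (A : 'M[R]_(m, n)) c x d :
    polyhedron A c x -> (forall i, (A *m x) i 0 = c i 0 -> (A *m d) i 0 <= 0) ->
  exists2 t : R, 0 < t & polyhedron A c (x + t *: d).
Proof.
move=> Px Pd.
have [||t t0 ht] := @small_step 'I_m (fun i => c i 0 - (A *m x) i 0)
  (fun i => (A *m d) i 0).
- by move=> i; rewrite subr_ge0; apply: Px.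
- by move=> i e; apply: Pd; lra.
exists t => // i; rewrite mulmxDr -scalemxAr !mxE; have := ht i.
by rewrite !mxE; lra.
Qed.

(** The algebraic form of a vertex: the active rows have full rank. *)
Definition extreme m n (A : 'M[R]_(m, n)) c x : Prop :=
  polyhedron A c x /\
  forall d : 'cV[R]_n, (forall i, (A *m x) i 0 = c i 0 -> (A *m d) i 0 = 0) ->
    d = 0.

(** This says that no direction recedes to infinity.  It replaces boundedness
    in the induction below, where it is easier to check for a section of a
    cone. *)
Definition recession_free m n (A : 'M[R]_(m, n)) : Prop :=
  forall d : 'cV[R]_n, d != 0 -> exists i, 0 < (A *m d) i 0.

Definition active m n (A : 'M[R]_(m, n)) (c : 'cV[R]_m) (x : 'cV[R]_n) :
    {set 'I_m} :=
  [set i | (A *m x) i 0 == c i 0].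

(** Moving along a line that keeps the active constraints active, the first new
    constraint met enlarges the active set. *)
Lemma push_to_boundary m n (A : 'M[R]_(m, n)) c x d :
    recession_free A -> polyhedron A c x -> d != 0 ->
    (forall i, (A *m x) i 0 = c i 0 -> (A *m d) i 0 = 0) ->
  exists2 t : R, 0 < t & polyhedron A c (x + t *: d) /\
    active A c x \proper active A c (x + t *: d).
Proof.
move=> rA Px d0 hd; have [i0 hi0] := rA d d0.
pose g i := (c i 0 - (A *m x) i 0) / (A *m d) i 0.
case: (@arg_minP _ _ _ i0 (fun i => 0 < (A *m d) i 0) g hi0) => j hj gmin.
have gj : 0 < g j.
  rewrite divr_gt0 // subr_gt0 lt_def Px andbT eq_sym.
  by apply/eqP => /hd hj0; rewrite hj0 ltxx in hj.
exists (g j) => //; split.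
  move=> i; rewrite mulmxDr -scalemxAr mxE [X in _ + X]mxE.
  case: (ltP 0 ((A *m d) i 0)) => hi.
    by have := gmin i hi; rewrite {2}/g ler_pdivlMr //; lra.
  have := Px i; nra.
apply/properP; split.
  apply/fintype.subsetP => i; rewrite !inE => /eqP e;
    rewrite mulmxDr -scalemxAr.
  by rewrite mxE [X in _ + X]mxE hd // mulr0 addr0 e.
exists j; rewrite !inE.
  rewrite mulmxDr -scalemxAr mxE [X in _ + X]mxE /g divfK ?lt0r_neq0 //.
  by apply/eqP; rewrite addrC subrK.
by apply/eqP => /hd e; rewrite e ltxx in hj.
Qed.

(** Minkowski's theorem that a polytope is the hull of its vertices, as an
    induction principle that avoids finite convex combinations: a point that is
    not extreme lies between two points with more active constraints. *)
Lemma polyhedron_ind m n (A : 'M[R]_(m, n)) c (C : set 'cV[R]_n) :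
    recession_free A -> convex C -> (forall x, extreme A c x -> C x) ->
  forall x, polyhedron A c x -> C x.
Proof.
move=> rA cC hC x; have [N] := ubnP #|~: active A c x|.
elim: N x => // N IH x; rewrite ltnS => hN Px.
have [ex|nex] := pselect (extreme A c x); first exact: hC.
have [d [hd d0]] : exists d : 'cV[R]_n,
    (forall i, (A *m x) i 0 = c i 0 -> (A *m d) i 0 = 0) /\ d != 0.
  apply: contrapT => h; apply: nex; split; first exact: Px.
  by move=> d hd; have [//|d0] := eqVneq d 0; case: h; exists d.
have step e : e != 0 ->
    (forall i, (A *m x) i 0 = c i 0 -> (A *m e) i 0 = 0) ->
    exists2 t : R, 0 < t & C (x + t *: e).
  move=> e0 he; have [t t0 [Pt At]] := push_to_boundary rA Px e0 he.
  exists t => //; apply: IH => //; apply: leq_trans hN.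
  by apply: proper_card; rewrite properC.
have [t t0 Ct] := step d d0 hd.
have [s s0 Cs] : exists2 s : R, 0 < s & C (x + s *: - d).
  by apply: step; [rewrite oppr_eq0|move=> i /hd e; rewrite mulmxN mxE e oppr0].
have -> : x = (1 - t / (t + s)) *: (x + t *: d) + t / (t + s) *: (x + s *: - d).
  apply/colP => i; rewrite !mxE; field; lra.
by apply: cC => //; rewrite divr_gt0 ?addr_gt0 //= ltr_pdivrMr ?addr_gt0 //;
  lra.
Qed.

End Active.

(** * Faces and vertices of polytopes *)

Section Polytope.
Variable R : realType.

(** Along a direction without recession every coordinate that changes would
    exceed the bound. *)
Lemma polytope_recession n (P : set 'cV[R]_n) : polytope P -> P !=set0 ->
  exists m (A : 'M[R]_(m, n)) c, P = polyhedron A c /\ recession_free A.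
Proof.
case=> -[m [A [c eP]]] [M hM] [x Px]; exists m, A, c; split=> // d d0.
apply: contrapT => nd; have {}nd i : (A *m d) i 0 <= 0.
  by rewrite leNgt; apply/negP => h; apply: nd; exists i.
have [l dl] : exists l, d l 0 != 0.
  apply: contrapT => h; case/negP: d0; apply/eqP/colP => l; rewrite mxE.
  by apply: contrapT => /eqP e; apply: h; exists l.
have dl0 : 0 < `|d l 0| by rewrite normr_gt0.
pose t := (M + `|x l 0| + 1) / `|d l 0|.
have M0 : 0 <= M by apply: le_trans (hM x Px l).
have t0 : 0 <= t by rewrite divr_ge0 // !addr_ge0.
have Pt : P (x + t *: d).
  rewrite eP => i; rewrite mulmxDE mulmxZE.
  by have := nd i; move: Px; rewrite eP => /(_ i); nra.
have := hM _ Pt l; rewrite !mxE => h.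
have : `|t * d l 0| <= M + `|x l 0|.
  have -> : t * d l 0 = (x l 0 + t * d l 0) - x l 0 by ring.
  by apply: le_trans (ler_normB _ _) _; rewrite lerD2r.
by rewrite normrM (ger0_norm t0) /t divfK ?lt0r_neq0 //; lra.
Qed.

Lemma vertexP n (P : set 'cV[R]_n) v :
  vertex P v <-> exists u, face P u = [set v].
Proof.
split; last by case=> u e; right; exists u.
case=> [e|[u e]]; last by exists u.
by have : [set v] v by []; rewrite e.
Qed.

Lemma vertex_in n (P : set 'cV[R]_n) v : vertex P v -> P v.
Proof. by case/vertexP => u e; have : [set v] v by []; rewrite -e => -[]. Qed.

Lemma face0 n (P : set 'cV[R]_n) : face P 0 = P.
Proof.
apply/seteqP; split=> [x []//|x Px]; split=> // y _.
by rewrite !(dotC 0) !dot0r.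
Qed.

(** The sum of the active rows exposes an extreme point. *)
Lemma extreme_vertex m n (A : 'M[R]_(m, n)) c x :
  extreme A c x -> vertex (polyhedron A c) x.
Proof.
case=> Px hx; apply/vertexP.
pose a i := (A *m x) i 0 == c i 0.
exists (\sum_(i | a i) (row i A)^T).
have ux y : polyhedron A c y ->
    \sum_(i | a i) (A *m y) i 0 <= \sum_(i | a i) (A *m x) i 0.
  by move=> Py; apply: ler_sum => i /eqP ->; apply: Py.
apply/seteqP; split=> [y [Py hy]|_ ->]; last first.
  by split=> // y Py; rewrite !dot_sum_rows; apply: ux.
apply/eqP; rewrite -subr_eq0; apply/eqP; apply: hx => i ai.
have := hy _ Px; rewrite !dot_sum_rows => le_xy.
rewrite mulmxBE; apply/eqP; rewrite subr_eq0; apply/eqP.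
apply: (@sum_tight _ _ a (fun i => (A *m y) i 0) (fun i => (A *m x) i 0)) => //.
  by move=> j /eqP ->; apply: Py.
exact/eqP.
Qed.

(** A convex combination reaches the maximum of u only if both ends do. *)
Lemma face_ind_extreme m n (A : 'M[R]_(m, n)) c u (C : set 'cV[R]_n) :
    recession_free A -> convex C ->
    (forall x, extreme A c x -> face (polyhedron A c) u x -> C x) ->
  forall x, face (polyhedron A c) u x -> C x.
Proof.
move=> rA cC hC x [Px hx]; set P := polyhedron A c in hC Px hx *.
pose D := [set y | P y /\ (dot u y = dot u x -> C y)].
suff [_ h] : D x by exact: h.
apply: polyhedron_ind Px => //.
  move=> y z t [Py Cy] [Pz Cz] t01; split; first exact: polyhedron_convex.
  rewrite dotDr !dotZr => e; have := hx y Py; have := hx z Pz => zx yx.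
  by apply: cC => //; [apply: Cy|apply: Cz]; apply/eqP; rewrite eq_le; nra.
move=> y ey; split; first by case: ey.
move=> e; apply: hC => //; split; first by case: ey.
by move=> z Pz; rewrite e; apply: hx.
Qed.

Lemma vertex_extreme m n (A : 'M[R]_(m, n)) c v :
  recession_free A -> vertex (polyhedron A c) v -> extreme A c v.
Proof.
move=> rA /vertexP [u e].
have : face (polyhedron A c) u v by rewrite e.
apply: (@face_ind_extreme _ _ _ _ _ [set _ | extreme A c v]) => //.
by move=> x ex; rewrite e => <-.
Qed.

Lemma face_ind n (P : set 'cV[R]_n) u (C : set 'cV[R]_n) :
    polytope P -> convex C ->
    (forall v, vertex P v -> face P u v -> C v) ->
  forall x, face P u x -> C x.
Proof.
move=> pP cC hC x Fx; have nP : P !=set0 by exists x; case: Fx.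
have [m [A [c [eP rA]]]] := polytope_recession pP nP.
move: Fx hC; rewrite eP => Fx hC; apply: face_ind_extreme Fx => // y ey.
by apply: hC; apply: extreme_vertex.
Qed.

Lemma polytope_ind n (P : set 'cV[R]_n) (C : set 'cV[R]_n) :
    polytope P -> convex C -> (forall v, vertex P v -> C v) ->
  forall x, P x -> C x.
Proof.
move=> pP cC hC x; rewrite -(face0 P); apply: face_ind => // v vv _.
exact: hC.
Qed.

(** An extreme point is determined by its active set, and there are finitely
    many such sets. *)
Lemma finite_vertices n (P : set 'cV[R]_n) : polytope P ->
  exists V : seq 'cV[R]_n, forall v, (v \in V) <-> vertex P v.
Proof.
move=> pP; have [nP|eP] := pselect (P !=set0); last first.
  by exists [::] => v; split=> // /vertex_in Pv; case: eP; exists v.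
have [m [A [c [eP rA]]]] := polytope_recession pP nP.
pose S (J : {set 'I_m}) := [set x | extreme A c x /\ active A c x = J].
pose W := [seq xget 0 (S J) | J : {set 'I_m}].
exists [seq v <- W | `[< vertex P v >]] => v; rewrite mem_filter.
split; first by case/andP => /asboolP.
move=> vv; apply/andP; split; first exact/asboolP.
move: vv; rewrite eP => /(vertex_extreme rA) ev; apply/mapP.
exists (active A c v); first by rewrite mem_enum.
case: (@xgetPex _ 0 (S (active A c v))); first by exists v.
set w := xget _ _ => -[Pw _] ew; apply/eqP; rewrite -subr_eq0; apply/eqP.
case: ev => Pv; apply=> i ai.
have : i \in active A c w by rewrite ew inE ai.
by rewrite inE mulmxBE ai => /eqP ->; rewrite subrr.
Qed.

Lemma seq_argmax (T : eqType) (f : T -> R) (s : seq T) x0 : x0 \in s ->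
  exists2 x, x \in s & forall y, y \in s -> f y <= f x.
Proof.
elim: s x0 => // a s IH x0 _; case: s IH => [_|b s IH].
  by exists a; rewrite ?inE // => y; rewrite inE => /eqP ->.
have [x xs hx] := IH b (mem_head _ _).
have [le|/ltW le] := lerP (f x) (f a).
  exists a; first exact: mem_head.
  by move=> y; rewrite inE => /predU1P [->//|/hx]; move/le_trans; apply.
exists x; first by rewrite inE xs orbT.
by move=> y; rewrite inE => /predU1P [->//|/hx].
Qed.

Lemma polytope_max n (P : set 'cV[R]_n) u : polytope P -> P !=set0 ->
  exists2 v, vertex P v & face P u v.
Proof.
move=> pP [x Px]; have [V hV] := finite_vertices pP.
have [v0 v0V] : exists v, v \in V.
  apply: contrapT => nV; have : set0 x; last by [].
  by apply: (polytope_ind pP _ _ Px) => // v /hV vV; case: nV; exists v.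
have [v /hV vv vmax] := seq_argmax (dot u) v0V.
exists v => //; split; first exact: vertex_in.
apply: polytope_ind => // [y z t|w /hV]; last exact: vmax.
by rewrite /= dotDr !dotZr; nra.
Qed.

Lemma face_has_vertex n (P F : set 'cV[R]_n) : polytope P -> faces P F ->
  F !=set0 -> exists2 v, vertex P v & F v.
Proof.
move=> pP [->[]//|[u ->]] [x [Px _]].
by apply: polytope_max => //; exists x.
Qed.

Lemma face_max n (P : set 'cV[R]_n) u w : polytope P -> P !=set0 ->
  exists v, [/\ vertex P v, face P u v &
    forall y, face P u y -> dot w y <= dot w v].
Proof.
move=> pP nP; have [V hV] := finite_vertices pP.
have [v0 /hV vV0 Fv0] := polytope_max u pP nP.
pose W := [seq v <- V | `[< face P u v >]].
have v0W : v0 \in W by rewrite mem_filter vV0 andbT; apply/asboolP.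
have [v vW vmax] := seq_argmax (dot w) v0W.
move: vW; rewrite mem_filter => /andP [/asboolP Fv /hV vv].
exists v; split=> //; apply: face_ind => // [y z t|x vx Fx].
  by rewrite /= dotDr !dotZr; nra.
by apply: vmax; rewrite mem_filter; apply/andP; split; [apply/asboolP|apply/hV].
Qed.

(** A vertex of P in the face lies strictly below v for u, unless it is v.  Were
    v not a vertex of P, the whole face would lie strictly below v. *)
Lemma vertex_face n (P : set 'cV[R]_n) w u v :
  polytope P -> face (face P w) u = [set v] -> vertex P v.
Proof.
move=> pP e; have [[Pv wv] uv] : face (face P w) u v by rewrite e.
pose C := [set x | dot u x < dot u v \/ vertex P v].
suff : C v by case=> //; rewrite ltxx.
apply: (@face_ind _ P w) => //.
  move=> x y t [xv|]; last by right.
  case=> [yv|]; last by right.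
  by left; rewrite /= dotDr !dotZr; nra.
move=> x vx Fx; have [xv|xv] := eqVneq x v; first by right; rewrite -xv.
left; rewrite lt_neqAle uv // andbT; apply: contra_neq xv => xv.
by have : face (face P w) u x;
  [split=> // y Fy; rewrite xv; apply: uv|rewrite e].
Qed.

End Polytope.

(** * Normal fans and their maximal cones *)

Section NormalFans.
Variable R : realType.

(** The maximal cones of the normal fan.  All the others are intersections of
    these. *)
Definition vertex_cones n (P : set 'cV[R]_n) : set (set 'cV[R]_n) :=
  [set normal_cone P [set v] | v in vertex P].

Lemma normal_cone1 n (P : set 'cV[R]_n) v u : P v ->
  normal_cone P [set v] u <-> forall y, P y -> dot u y <= dot u v.
Proof.
by move=> Pv; split=> [h|h _ ->//]; have [] : face P u v by apply: h.
Qed.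

Lemma face_normal_cone1 n (P : set 'cV[R]_n) v u :
  normal_cone P [set v] u <-> face P u v.
Proof. by split=> [h|h _ ->//]; apply: h. Qed.

(** A face is the hull of its vertices, so that its normal cone is the
    intersection of theirs. *)
Lemma normal_cone_face n (P : set 'cV[R]_n) u w : polytope P ->
  normal_cone P (face P u) w <->
  forall s, vertex_cones P s -> s u -> s w.
Proof.
move=> pP; split=> [h _ [v vv <-]|h].
  by rewrite !face_normal_cone1 => /h.
apply: face_ind => //; first exact: (face_convex (polytope_convex pP)).
move=> v vv uv; apply/face_normal_cone1; apply: h; first by exists v.
exact/face_normal_cone1.
Qed.

Lemma normal_fan_cones n (P : set 'cV[R]_n) : polytope P -> P !=set0 ->
  normal_fan P =
  [set [set w | forall s, vertex_cones P s -> s u -> s w] | u in setT].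
Proof.
move=> pP nP; have E u : [set w | forall s, vertex_cones P s -> s u -> s w]
    = normal_cone P (face P u).
  by apply/seteqP; split=> w /(normal_cone_face u w pP).
apply/seteqP; split=> [N [F [[->[]//|[u ->]] nF ->]]|N [u _ <-]].
  by exists u => //; rewrite E.
exists (face P u); split; rewrite ?E //; first by right; exists u.
by have [v _] := polytope_max u pP nP; exists v.
Qed.

(** The cone of a vertex v is maximal in the fan.  As a cone of the other fan
    it is contained in the cone of a vertex w, which in turn belongs to the
    first fan; a functional exposing v shows that nothing has grown. *)
Lemma normally_isomorphic_sub n (P Q : set 'cV[R]_n) : polytope P ->
  polytope Q -> normal_fan P = normal_fan Q ->
    vertex_cones P `<=` vertex_cones Q.
Proof.
move=> pP pQ e _ [v vv <-]; have [u eu] := (vertexP _ _).1 vv.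
have : normal_fan P (normal_cone P [set v]).
  by exists [set v]; split => //; exists v.
rewrite e => -[F [fF nF eF]]; have [w vw Fw] := face_has_vertex pQ fF nF.
have : normal_fan Q (normal_cone Q [set w]).
  by exists [set w]; split => //; exists w.
rewrite -e => -[G [fG [z Gz] eG]].
have FG : normal_cone Q F `<=` normal_cone Q [set w] by move=> a ha _ ->;
  apply: ha.
have eGv : G = [set v].
  have /= Gv : G `<=` [set v].
    rewrite -eu; suff : normal_cone P G u by [].
    by rewrite -eG; apply: FG; rewrite -eF; apply/face_normal_cone1; rewrite eu.
  by apply/seteqP; split => // _ ->; rewrite -(Gv z Gz).
by exists w; rewrite // eG eGv.
Qed.

Lemma normally_isomorphicP n (P Q : set 'cV[R]_n) : polytope P -> polytope Q ->
    P !=set0 -> Q !=set0 ->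
  normally_isomorphic P Q <-> vertex_cones P = vertex_cones Q.
Proof.
move=> pP pQ nP nQ; split=> [e|e].
  by apply/seteqP; split; apply: normally_isomorphic_sub.
by rewrite /normally_isomorphic !normal_fan_cones // e.
Qed.

Lemma vertex_cone_inj n (P : set 'cV[R]_n) v w : vertex P v -> P w ->
  normal_cone P [set v] = normal_cone P [set w] -> v = w.
Proof.
move=> vv Pw e; have [u eu] := (vertexP _ _).1 vv.
have : normal_cone P [set w] u.
  by rewrite -e; apply/face_normal_cone1; rewrite eu.
by move/face_normal_cone1; rewrite eu.
Qed.

End NormalFans.

(** Bundles compare fibres inside R^(k + n).  A normal fan there is the preimage
    of the fan in R^n under the transpose of the embedding, which is surjective,
    so that the comparison can be made in R^n. *)
Section Embedding.
Variables (R : realType) (k n : nat) (E : 'M[R]_(k, n)) (L : 'M[R]_(n, k)).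
Hypothesis LE : L *m E = 1%:M.

Definition emb (a : 'cV[R]_k) (S : set 'cV[R]_n) : set 'cV[R]_k :=
  [set a + E *m y | y in S].

Lemma emb_inj (a : 'cV[R]_k) : injective (fun y => a + E *m y).
Proof.
by move=> x y /addrI /(congr1 (mulmx L)); rewrite !mulmxA LE !mul1mx.
Qed.

Lemma emb_subset a S T : (emb a S `<=` emb a T) <-> (S `<=` T).
Proof.
split=> [sub y Sy|sub _ [y /sub Ty <-]]; last by exists y.
by have [|z Tz /emb_inj <-//] := sub (a + E *m y); exists y.
Qed.

Lemma face_emb a S u : face (emb a S) u = emb a (face S (E^T *m u)).
Proof.
apply/seteqP; split=> [_ [[y Sy <-] hy]|_ [y [Sy hy] <-]].
  exists y => //; split=> // z Sz; have := hy (a + E *m z).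
  by rewrite !dotDr !dot_mulmx lerD2l; apply; exists z.
split; first by exists y.
by move=> _ [z Sz <-]; rewrite !dotDr !dot_mulmx lerD2l; apply: hy.
Qed.

Lemma normal_cone_emb a S F :
  normal_cone (emb a S) (emb a F) = [set u | normal_cone S F (E^T *m u)].
Proof.
by apply/seteqP; split=> u; rewrite /normal_cone /= face_emb emb_subset.
Qed.

Lemma trmx_surj (u : 'cV[R]_n) : exists w, E^T *m w = u.
Proof. by exists (L^T *m u); rewrite mulmxA -trmx_mul LE trmx1 mul1mx. Qed.

Lemma vertex_emb a S y : vertex (emb a S) (a + E *m y) <-> vertex S y.
Proof.
have e1 : [set a + E *m y] = emb a [set y].
  apply/seteqP; split=> [_ ->|_ [_ -> <-]//]; by exists y.
rewrite !vertexP; split=> [[u]|[u eu]].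
  rewrite face_emb e1 => /seteqP [/emb_subset s1 /emb_subset s2].
  by exists (E^T *m u); apply/seteqP.
have [w wu] := trmx_surj u; exists w.
by rewrite face_emb e1 wu eu.
Qed.

Lemma normal_fan_emb a S : normal_fan (emb a S) =
  [set [set u | N (E^T *m u)] | N in normal_fan S].
Proof.
apply/seteqP; split=> N.
  case=> F [[->[]//|[u ->]]]; rewrite face_emb => -[_ [y Fy _]] ->.
  rewrite normal_cone_emb.
  exists (normal_cone S (face S (E^T *m u))) => //.
  by exists (face S (E^T *m u)); split=> //;
    [right; exists (E^T *m u)|exists y].
case=> _ [F [[->[]//|[u ->]] [y Fy] ->] <-]; have [w wu] := trmx_surj u.
exists (face (emb a S) w); split; first by right; exists w.
  by rewrite face_emb wu; exists (a + E *m y), y.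
by rewrite face_emb wu normal_cone_emb.
Qed.

Lemma normally_isomorphic_emb a b S T :
  normally_isomorphic (emb a S) (emb b T) <-> normally_isomorphic S T.
Proof.
rewrite /normally_isomorphic !normal_fan_emb; split=> [e|->//].
have inj (N N' : set 'cV[R]_n) :
    [set u | N (E^T *m u)] = [set u | N' (E^T *m u)] -> N = N'.
  move=> /seteqP [s1 s2]; apply/seteqP; split=> u; have [w <-] := trmx_surj u.
    exact: s1.
  exact: s2.
have sub S' T' : [set [set u | N (E^T *m u)] | N in normal_fan S'] `<=`
    [set [set u | N (E^T *m u)] | N in normal_fan T'] ->
    normal_fan S' `<=` normal_fan T'.
  move=> h N fN; have [|N' fN' /inj <-//] := h [set u | N (E^T *m u)].
  by exists N.
by apply/seteqP; split; apply: sub; rewrite e.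
Qed.

End Embedding.

(** * The tangent cone at a vertex *)

Section TangentCone.
Variable R : realType.

(** The cone at v is cut by the hyperplane u0 = -1, where u0 is the sum of the
    active rows.  The section is recession free, and each of its extreme points
    spans an edge of P, because the active rows that vanish on it have rank
    n - 1. *)
Lemma tangent_cone n (P : set 'cV[R]_n) v (K : set 'cV[R]_n) :
    polytope P -> vertex P v -> convex K -> K 0 ->
    (forall t d, 0 < t -> K d -> K (t *: d)) ->
    (forall E d, edge P E -> E v -> E (v + d) -> d != 0 -> K d) ->
  forall x, P x -> K (x - v).
Proof.
move=> pP vv cK K0 KZ KE x Px; have nP : P !=set0 by exists x.
have [m [A [c [eP rA]]]] := polytope_recession pP nP.
have [Av hv] : extreme A c v by apply: vertex_extreme => //; rewrite -eP.
pose act := [pred i | (A *m v) i 0 == c i 0].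
pose B : 'M[R]_(m, n) := \matrix_i (if act i then row i A else 0).
have BE i (d : 'cV[R]_n) : (B *m d) i 0 = if act i then (A *m d) i 0 else 0.
  rewrite dot_row rowK; case: ifP => _; first by rewrite -dot_row.
  by rewrite dotE trmxK mul0mx mxE.
pose u0 := \sum_(i | act i) (row i A)^T.
have u0E := dot_sum_rows A act; rewrite -/u0 in u0E.
have zero (d : 'cV[R]_n) : (forall i, act i -> (A *m d) i 0 <= 0) ->
    0 <= dot u0 d -> d = 0.
  move=> le0 ge0; apply: hv => i /eqP ai.
  apply: (@sum_tight _ _ act (fun i => (A *m d) i 0) (fun=> 0)) => //.
  by rewrite big1 // -u0E.
(* the rows of A' and the bounds c' say that d is in the tangent cone and that
   u0 takes the value -1 at d *)
pose A' := col_mx B (col_mx u0^T (- u0^T)).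
pose c' : 'cV[R]_(m + (1 + 1)) :=
  col_mx 0 (col_mx (const_mx (-1)) (const_mx 1)).
have A'B (d : 'cV[R]_n) i : (A' *m d) (lshift _ i) 0 = (B *m d) i 0.
  by rewrite mul_col_mx col_mxEu.
have A'u (d : 'cV[R]_n) i : (A' *m d) (rshift _ (lshift _ i)) 0 = dot u0 d.
  by rewrite mul_col_mx col_mxEd mul_col_mx col_mxEu dotE ord1.
have A'n (d : 'cV[R]_n) i : (A' *m d) (rshift _ (rshift _ i)) 0 = - dot u0 d.
  by rewrite mul_col_mx col_mxEd mul_col_mx col_mxEd dotE mulNmx mxE ord1.
have c'B i : c' (lshift _ i) 0 = 0 by rewrite col_mxEu mxE.
have c'u i : c' (rshift _ (lshift _ i)) 0 = -1 by rewrite col_mxEd col_mxEu mxE.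
have c'n i : c' (rshift _ (rshift _ i)) 0 = 1 by rewrite col_mxEd col_mxEd mxE.
have inK (d : 'cV[R]_n) : polyhedron A' c' d <->
    (forall i, act i -> (A *m d) i 0 <= 0) /\ dot u0 d = -1.
  split=> [h|[h1 h2] i].
    split=> [i ai|].
      by have := h (lshift _ i); rewrite A'B c'B BE ai.
    have := h (rshift _ (lshift _ ord0)); have := h (rshift _ (rshift _ ord0)).
    by rewrite A'u c'u A'n c'n; lra.
  case: (split_ordP i) => j ->; last case: (split_ordP j) => k ->.
  - by rewrite A'B c'B BE; case: ifP => // /h1.
  - by rewrite A'u c'u h2.
  by rewrite A'n c'n h2; lra.
have rA' : recession_free A'.
  move=> d d0; apply: contrapT => nd.
  have {}nd i : (A' *m d) i 0 <= 0.
    by rewrite leNgt; apply/negP => h; apply: nd; exists i.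
  case/eqP: d0; apply: zero => [i ai|].
    by have := nd (lshift _ i); rewrite A'B BE ai.
  by have := nd (rshift _ (rshift _ ord0)); rewrite A'n; lra.
have [->|xv] := eqVneq x v; first by rewrite subrr.
have cx i : act i -> (A *m (x - v)) i 0 <= 0.
  by move=> /eqP ai; rewrite mulmxBE ai; move: Px; rewrite eP => /(_ i); lra.
have ux : dot u0 (x - v) < 0.
  rewrite ltNge; apply/negP => /(zero _ cx) /eqP; rewrite subr_eq0.
  by rewrite (negPf xv).
pose s := - dot u0 (x - v); have s0 : 0 < s by rewrite /s; lra.
suff Kx : K (s^-1 *: (x - v)).
  by have := KZ _ _ s0 Kx; rewrite scalerA divff ?lt0r_neq0 // scale1r.
apply: polyhedron_ind rA' cK _ _ _; last first.
  apply/inK; split; last by rewrite dotZr /s; field;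
    rewrite -oppr_eq0 lt0r_neq0.
  by move=> i /cx; rewrite mulmxZE pmulr_rle0 // invr_gt0.
move=> d [/inK [d1 d2] hd].
have [t t0 Pt] : exists2 t, 0 < t & P (v + t *: d).
  by rewrite eP; apply: polyhedron_step => // i /eqP; apply: d1.
pose J := [pred i | act i && ((A *m d) i 0 == 0)].
pose w := \sum_(i | J i) (row i A)^T.
have wE := dot_sum_rows A J; rewrite -/w in wE.
have Ev : face P w v.
  split=> [|y]; rewrite eP // => Py; rewrite !wE; apply: ler_sum => i.
  by case/andP => /eqP -> _; apply: Py.
have Et : face P w (v + t *: d).
  split=> // y Py; rewrite dotDr dotZr (wE d).
  rewrite (big1 _ _ _ (fun i Ji => eqP (proj2 (andP Ji)))).
  by rewrite mulr0 addr0; case: Ev => _; apply.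
have El (y : 'cV[R]_n) : face P w y -> y = v + (- dot u0 (y - v)) *: d.
  case=> Py hy; apply/eqP; rewrite -subr_eq0; apply/eqP.
  have Jy i : J i -> (A *m y) i 0 = c i 0.
    apply: (@sum_tight _ _ J (fun i => (A *m y) i 0) (fun i => c i 0)) =>
      [j _|]; first by move: Py; rewrite eP; apply.
    apply: le_trans (_ : dot w v <= _); first by rewrite wE;
      apply: ler_sum => j /andP [/eqP ->].
    by rewrite -wE; apply: hy; rewrite eP.
  apply: hd => i; case: (split_ordP i) => j ->;
    last case: (split_ordP j) => k ->.
  - rewrite !A'B c'B !BE; case: ifP => // aj /eqP dj.
    have Jj : J j by apply/andP; split.
    by rewrite mulmxBE mulmxDE mulmxZE Jy // (eqP dj) (eqP aj); ring.
  - by rewrite !A'u => _; rewrite (dotBr u0 y (_ + _)) (dotDr u0 v) dotZr d2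
      (dotBr u0 y v); ring.
  by rewrite !A'n => _; rewrite (dotBr u0 y (_ + _)) (dotDr u0 v) dotZr d2
    (dotBr u0 y v); ring.
have d0 : d != 0 by apply/eqP => e; move: d2; rewrite e dot0r; lra.
suff Kt : K (t *: d).
  have := KZ t^-1 _ _ Kt; rewrite scalerA mulVf ?lt0r_neq0 // scale1r; apply.
  by rewrite invr_gt0.
apply: (KE (face P w)) => //; last first.
  by rewrite scaler_eq0 negb_or d0 lt0r_neq0.
split; first by right; exists w.
exists v, (t *: d); split=> //.
- by move=> j; rewrite (_ : col j _ = t *: d) //; apply/colP => i;
    rewrite !mxE ord1.
- by rewrite -mxrank_tr rank_rV trmx_eq0 scaler_eq0 negb_or d0 lt0r_neq0.
move=> y /El {1}->; exists (const_mx (- dot u0 (y - v) / t)).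
congr (_ + _); apply/colP => i; rewrite !mxE big_ord_recl big_ord0 !mxE.
by rewrite addr0 ord1; field; rewrite lt0r_neq0.
Qed.

End TangentCone.

(** * Primitive vectors and unimodular matrices *)

Section Primitive.
Variable n : nat.
Implicit Types u w : 'cV[int]_n.

Lemma primitiveP u :
  primitive u <-> forall (s : int) w, u = s *: w -> `|s|%N = 1%N.
Proof.
rewrite /primitive; set g := \big[_/_]_(i < n) _; split=> [g1 s w e|h].
  apply/eqP; rewrite -dvdn1 -g1; apply/dvdn_biggcdP => i _.
  by rewrite e mxE abszM dvdn_mulr.
pose w := \col_i divz (u i 0) g%:Z.
suff e : u = g%:Z *: w by apply: (h _ _ e).
apply/colP => i; rewrite !mxE mulrC divzK // /dvdz /=.
exact: (@biggcdn_inf _ i).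
Qed.

Lemma primitive_part u : u != 0 ->
  exists2 g : nat, (0 < g)%N & exists2 w, primitive w & u = g%:Z *: w.
Proof.
move=> u0; pose g := \big[gcdn/0%N]_(i < n) absz (u i 0).
pose w := \col_i divz (u i 0) g%:Z.
have e : u = g%:Z *: w.
  apply/colP => i; rewrite !mxE mulrC divzK // /dvdz /=.
  exact: (@biggcdn_inf _ i).
have g0 : (0 < g)%N.
  rewrite lt0n; apply/eqP => g0; case/eqP: u0.
  by rewrite e g0 scale0r.
exists g => //; exists w => //; apply/primitiveP => s z wz.
have : (g * `|s| %| g)%N.
  apply/dvdn_biggcdP => i _; rewrite e wz !mxE mulrA !abszM absz_nat.
  by rewrite dvdn_mulr.
by rewrite -{2}(muln1 g) dvdn_pmul2l // dvdn1 => /eqP.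
Qed.

Lemma primitive_mul1 u (w : 'rV[int]_n) : (w *m u) 0 0 = 1 -> primitive u.
Proof.
move=> e; apply/primitiveP => s z uz; apply/eqP; rewrite -dvdn1.
have -> : 1%N = `|(1 : int)|%N by [].
by rewrite -e uz -scalemxAr mxE abszM dvdn_mulr.
Qed.

Lemma primitive_scale (s : int) u w :
  primitive u -> u = s *: w -> 0 <= s -> u = w.
Proof.
move=> /primitiveP pu e s0; have := pu _ _ e; move: e; case: s s0 => // s _ e.
by rewrite absz_nat => s1; rewrite e s1 scale1r.
Qed.

End Primitive.

Section IntegerMatrices.
Variable R : realType.

Lemma zmxM m n p (A : 'M[int]_(m, n)) (B : 'M[int]_(n, p)) :
  zmx R (A *m B) = zmx R A *m zmx R B.
Proof. exact: map_mxM. Qed.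

Lemma zmxD m n (A B : 'M[int]_(m, n)) : zmx R (A + B) = zmx R A + zmx R B.
Proof. exact: map_mxD. Qed.

Lemma zmxN m n (A : 'M[int]_(m, n)) : zmx R (- A) = - zmx R A.
Proof. exact: map_mxN. Qed.

Lemma zmx1 n : zmx R (1%:M : 'M_n) = 1%:M.
Proof. exact: map_mx1. Qed.

Lemma zmx0 m n : zmx R (0 : 'M_(m, n)) = 0.
Proof. exact: map_mx0. Qed.

Lemma zmxZ m n (s : int) (A : 'M[int]_(m, n)) :
    zmx R (s *: A) = s%:~R *: zmx R A.
Proof. exact: map_mxZ. Qed.

Lemma zmx_inj m n : injective (@zmx R m n).
Proof.
move=> A B /matrixP e; apply/matrixP => i j; have := e i j.
by rewrite !mxE => /intr_inj.
Qed.

Lemma zmxK n (M : 'M[int]_n) : M \in unitmx ->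
    zmx R M *m zmx R (invmx M) = 1%:M.
Proof. by move=> uM; rewrite -zmxM mulmxV // zmx1. Qed.

Lemma zmxVK n (M : 'M[int]_n) : M \in unitmx ->
    zmx R (invmx M) *m zmx R M = 1%:M.
Proof. by move=> uM; rewrite -zmxM mulVmx // zmx1. Qed.

Lemma zmx_unitmx n (M : 'M[int]_n) : M \in unitmx -> zmx R M \in unitmx.
Proof. by move=> uM; case/mulmx1_unit: (zmxK uM). Qed.

Lemma dot_zmx n (u w : 'cV[int]_n) :
  dot (zmx R u) (zmx R w) = ((u^T *m w) 0 0)%:~R.
Proof.
rewrite /dot mxE rmorph_sum; apply: eq_bigr => i _.
by rewrite !mxE rmorphM.
Qed.

Lemma zmx_col m n (A : 'M[int]_(m, n)) j : col j (zmx R A) = zmx R (col j A).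
Proof. by apply/colP => i; rewrite !mxE. Qed.

Lemma zmx_row m n (A : 'M[int]_(m, n)) j : row j (zmx R A) = zmx R (row j A).
Proof. by apply/rowP => i; rewrite !mxE. Qed.

Lemma zmx_tr m n (A : 'M[int]_(m, n)) : (zmx R A)^T = zmx R A^T.
Proof. by apply/matrixP => i j; rewrite !mxE. Qed.

Lemma zmx_col_mx m1 m2 n (A : 'M[int]_(m1, n)) (B : 'M[int]_(m2, n)) :
  zmx R (col_mx A B) = col_mx (zmx R A) (zmx R B).
Proof. exact: map_col_mx. Qed.

Lemma lattice_mul m n (A : 'M[int]_(m, n)) x :
  lattice x -> lattice (zmx R A *m x).
Proof. by case=> z ->; exists (A *m z); rewrite zmxM. Qed.

Lemma dot_lattice n (u : 'cV[int]_n) (x : 'cV[R]_n) : lattice x ->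
  exists z : int, dot (zmx R u) x = z%:~R.
Proof. by case=> z ->; eexists; rewrite dot_zmx. Qed.

(** The coordinate functionals of the basis formed by the columns of M; when M
    is the basis of edge directions at a vertex, their opposites are the outer
    facet normals there. *)
Definition coordf n (M : 'M[int]_n) j : 'cV[int]_n := (row j (invmx M))^T.

Lemma dot_coordf n (M : 'M[int]_n) j (a : 'cV[R]_n) : M \in unitmx ->
  dot (zmx R (coordf M j)) (zmx R M *m a) = a j 0.
Proof.
move=> uM; rewrite dotE zmx_tr trmxK -zmx_row mulmxA -row_mul zmxVK //.
by rewrite -row_mul mul1mx mxE.
Qed.

Lemma dot_coordf_col n (M : 'M[int]_n) j l : M \in unitmx ->
  dot (zmx R (coordf M j)) (zmx R (col l M)) = (j == l)%:R.
Proof.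
by move=> uM; rewrite -zmx_col colE dot_coordf // mxE eqxx andbT.
Qed.

Lemma invmx_row_col n (M : 'M[int]_n) j l : M \in unitmx ->
  (row j (invmx M) *m col l M) 0 0 = (j == l)%:R.
Proof.
by move=> uM; rewrite colE mulmxA -row_mul mulVmx // -colE !mxE.
Qed.

Lemma primitive_coordf n (M : 'M[int]_n) j : M \in unitmx ->
    primitive (coordf M j).
Proof.
move=> uM; apply: (@primitive_mul1 _ _ (col j M)^T).
by rewrite -trmx_mul mxE invmx_row_col // eqxx.
Qed.

Lemma primitive_col n (M : 'M[int]_n) j : M \in unitmx -> primitive (col j M).
Proof.
move=> uM; apply: (@primitive_mul1 _ _ (row j (invmx M))).
by rewrite invmx_row_col // eqxx.
Qed.

End IntegerMatrices.

(** * Smoothness through unimodular corners *)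

Section Corner.
Variables (R : realType) (n : nat).
Implicit Types (P : set 'cV[R]_n) (M : 'M[int]_n).

(** The local shape of a smooth polytope at a vertex, in terms of cone and
    generators instead of edges. *)
Record corner P v M : Prop := Corner {
  corner_in : P v;
  corner_unit : M \in unitmx;
  corner_sub : forall x, P x ->
    exists2 a : 'cV[R]_n, (forall j, 0 <= a j 0) & x = v + zmx R M *m a;
  corner_edge : forall j, exists2 t : R, 0 < t & P (v + t *: zmx R (col j M)) }.

Lemma dot_mul_cols u M (a : 'cV[R]_n) :
  dot u (zmx R M *m a) = \sum_j dot u (zmx R (col j M)) * a j 0.
Proof. by rewrite dot_mulmx_col; apply: eq_bigr => j _; rewrite zmx_col. Qed.

Lemma corner_cone P v M u : corner P v M ->
  normal_cone P [set v] u <-> forall j, dot u (zmx R (col j M)) <= 0.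
Proof.
case=> Pv uM sub edg; rewrite normal_cone1 //; split=> [h j|h x /sub [a a0 ->]].
  have [t t0 /h] := edg j; rewrite dotDr dotZr; nra.
rewrite dotDr dot_mul_cols gerDl sumr_le0 // => j _.
by have := h j; have := a0 j; nra.
Qed.

(** The cone of a polyhedron at a point is dual to its normal cone, so that the
    normal cone alone determines the corner. *)
Lemma corner_polyhedron m (A : 'M[R]_(m, n)) c v M :
    polyhedron A c v -> M \in unitmx ->
    (forall u, normal_cone (polyhedron A c) [set v] u <->
      forall j, dot u (zmx R (col j M)) <= 0) ->
  corner (polyhedron A c) v M.
Proof.
move=> Pv uM hM; split=> // [x Px|j].
  exists (zmx R (invmx M) *m (x - v)); last first.
    by rewrite mulmxA zmxK // mul1mx addrC subrK.
  move=> j; have /(hM _).2 :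
    forall l, dot (- zmx R (coordf M j)) (zmx R (col l M)) <= 0.
    by move=> l; rewrite dotNl dot_coordf_col // oppr_le0.
  rewrite normal_cone1 // => /(_ _ Px); rewrite !dotNl.
  rewrite -[X in 0 <= X](dot_coordf _ _ uM) mulmxA zmxK // mul1mx dotBr; lra.
apply: polyhedron_step => // i ai; rewrite dot_row.
apply: (hM _).1; rewrite normal_cone1 // => y Py.
by rewrite -!dot_row ai.
Qed.

Lemma corner_coordf P v M j x : corner P v M -> P x ->
  dot (zmx R (coordf M j)) v <= dot (zmx R (coordf M j)) x.
Proof.
case=> _ uM sub _ /sub [a a0 ->].
by rewrite dotDr dot_coordf // lerDl.
Qed.

Lemma corner_vertex P v M : corner P v M -> vertex P v.
Proof.
move=> cr; have [Pv uM sub edg] := cr.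
apply/vertexP; exists (- \sum_j zmx R (coordf M j)).
have dE a : dot (\sum_j zmx R (coordf M j)) (zmx R M *m a) = \sum_j a j 0.
  rewrite dotC dot_sumr; apply: eq_bigr => j _.
  by rewrite dotC dot_coordf.
apply/seteqP; split=> [x [Px /(_ v Pv)]|_ ->]; last first.
  split=> // y /sub [a a0 ->]; rewrite dotDr !dotNl dE.
  by rewrite gerDl oppr_le0 sumr_ge0.
have [a a0 ->] := sub x Px; rewrite dotDr !dotNl dE => h.
suff -> : a = 0 by rewrite mulmx0 addr0.
have /eqP : \sum_j a j 0 = 0.
  by apply/eqP; rewrite eq_le sumr_ge0 // andbT; lra.
rewrite psumr_eq0 // => /allP az; apply/colP => j.
by have /eqP := az j (mem_index_enum _); rewrite mxE.
Qed.

Lemma zmx_col_neq0 M j : M \in unitmx -> zmx R (col j M) != 0.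
Proof.
move=> uM; apply/eqP => e; have := dot_coordf_col R j j uM.
by rewrite e dot0r eqxx => /eqP; rewrite eq_sym oner_eq0.
Qed.

(** By rationality each edge direction at v is a positive multiple of a
    primitive vector, hence of a column of M; the tangent cone is generated by
    them. *)
Lemma smooth_corner P v : smooth P -> vertex P v -> exists M, corner P v M.
Proof.
case=> pP _ _ ratP baseP vv; have [M uM hM] := baseP v vv; exists M.
split=> //; first exact: vertex_in.
  pose K := [set d : 'cV[R]_n | forall j, 0 <= (zmx R (invmx M) *m d) j 0].
  have cK : convex K.
    move=> x y t Kx Ky t01 j; rewrite mulmxDE !mulmxZE.
    by have := Kx j; have := Ky j; nra.
  have K0 : K 0 by move=> j; rewrite mulmx0 mxE.
  have KZ t d : 0 < t -> K d -> K (t *: d).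
    by move=> t0 Kd j; rewrite mulmxZE; have := Kd j; nra.
  move=> x /(tangent_cone pP vv cK K0 KZ) Kx.
  exists (zmx R (invmx M) *m (x - v)); last first.
    by rewrite mulmxA zmxK // mul1mx addrC subrK.
  apply: Kx => E d eE Ev Ed d0.
  have [u u0 hu] := ratP E eE; have [t] := hu _ _ Ev Ed.
  rewrite addrC addKr => dE.
  have [g g0 [w pw uw]] := primitive_part u0.
  have key (s : R) (z : 'cV[int]_n) : 0 < s -> primitive z ->
      d = s *: zmx R z -> K d.
    move=> s0 pz dz; have [j zj] : exists j, z = col j M.
      apply/hM; split=> //; exists E; split=> //; exists s => //.
      by rewrite -dz.
    move=> l; rewrite dz mulmxZE -(@dot_coordf R n M l) // mulmxA zmxK //
      mul1mx.
    by rewrite zj dot_coordf_col // mulr_ge0 // ltW.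
  have dw : d = (t * g%:R) *: zmx R w by rewrite dE uw zmxZ scalerA.
  have g0' : 0 < g%:R :> R by rewrite ltr0n.
  have [t0|t0|t0] := ltrgt0P t.
  - by apply: key dw => //; rewrite mulr_gt0.
  - apply: (key (- (t * g%:R)) (- w)) => //; first by nra.
      apply/primitiveP => s z e; apply: ((primitiveP w).1 pw s (- z)).
      by rewrite scalerN -e opprK.
    by rewrite zmxN scalerN scaleNr opprK.
  by move: d0; rewrite dE t0 scale0r eqxx.
move=> j; have [_ [F [[fF _] _ [t t0 Ft]]]] :
  primitive_edge_direction P v (col j M).
  by apply/hM; exists j.
exists t => //; case: fF Ft => [->//|[u ->] []//].
Qed.

Definition ray_edge P v M j : set 'cV[R]_n :=
  [set x | P x /\ exists2 a : R, 0 <= a & x = v + a *: zmx R (col j M)].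

(** The face is exposed by the opposite of the sum of the other coordinate
    functionals. *)
Lemma ray_edgeP P v M j : corner P v M -> edge P (ray_edge P v M j).
Proof.
move=> cr; have [Pv uM sub edg] := cr; split; last first.
  have [t t0 Pt] := edg j; exists v, (t *: zmx R (col j M)); split.
  - by split=> //; exists 0; rewrite // scale0r addr0.
  - move=> i; rewrite (_ : col i _ = t *: zmx R (col j M)).
      by split => //; exists t; rewrite // ltW.
    by apply/colP => k; rewrite !mxE ?ord1.
  - rewrite -mxrank_tr rank_rV trmx_eq0 scaler_eq0 negb_or lt0r_neq0 //=.
    by rewrite zmx_col_neq0.
  move=> x [_ [a a0 ->]]; exists (const_mx (a / t)).
  congr (_ + _); apply/colP => i; rewrite !mxE big_ord_recl big_ord0 !mxE addr0.
  by field; rewrite lt0r_neq0.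
right; exists (- \sum_(l | l != j) zmx R (coordf M l)).
have dE a : dot (\sum_(l | l != j) zmx R (coordf M l)) (zmx R M *m a) =
    \sum_(l | l != j) a l 0.
  by rewrite dotC dot_sumr; apply: eq_bigr => l _; rewrite dotC dot_coordf.
apply/seteqP; split=> [x [Px [s s0 xs]]|x [Px /(_ v Pv)]].
  split=> // y /sub [a a0 ->].
  have -> : x = v + zmx R M *m (s *: delta_mx j 0).
    by rewrite xs -scalemxAr -colE zmx_col.
  rewrite !dotDr !dotNl !dE lerD2l lerN2 big1 ?sumr_ge0 // => l lj.
  by rewrite !mxE (negPf lj) mulr0.
have [a a0 xa] := sub x Px; rewrite xa dotDr !dotNl dE => h.
split; rewrite -?xa //; exists (a j 0) => //; rewrite xa; congr (_ + _).
have /eqP : \sum_(l | l != j) a l 0 = 0.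
  by apply/eqP; rewrite eq_le sumr_ge0 // andbT; lra.
rewrite psumr_eq0 // => /allP az.
have -> : a = a j 0 *: delta_mx j 0.
  apply/colP => l; rewrite !mxE andbT; case: eqVneq => [->|lj].
    by rewrite mulr1.
  have := az l (mem_index_enum _); rewrite lj => /eqP ->.
  by rewrite mulr0.
by rewrite -scalemxAr -colE zmx_col !mxE !eqxx mulr1.
Qed.

(** If x is another point of the edge and a_j is a nonzero coordinate of x - v,
    then column j of M is also in the direction of the edge, which has only
    one. *)
Lemma edge_ray P v M F : corner P v M -> edge P F -> F v ->
  exists j, F = ray_edge P v M j.
Proof.
move=> cr; have [Pv uM sub edg] := cr.
case=> -[->//|[u ->]] [x0 [D [Fx0 FD rD spanD]]] Fv.
have uM0 j : dot u (zmx R (col j M)) <= 0.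
  exact: ((corner_cone u cr).1 ((face_normal_cone1 _ _ _).2 Fv)).
have Fray j : dot u (zmx R (col j M)) = 0 -> face P u `<=` ray_edge P v M j ->
    face P u = ray_edge P v M j.
  move=> uj sb; apply/seteqP; split=> // x [Px [a a0 xa]]; split=> // y Py.
  by rewrite xa dotDr dotZr uj mulr0 addr0; case: Fv => _; apply.
have [x Fx xv] : exists2 x, face P u x & x != v.
  have [e|e] := eqVneq x0 v; last by exists x0.
  exists (x0 + col ord0 D); first exact: FD.
  rewrite e -subr_eq0 addrC addKr; apply/eqP => D0.
  have : D = 0 by apply/matrixP => i j; move/colP: D0 => /(_ i);
    rewrite !mxE (ord1 j).
  by move=> Dz; move: rD; rewrite Dz mxrank0.
have zer (y a : 'cV[R]_n) : face P u y -> (forall j, 0 <= a j 0) ->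
    y = v + zmx R M *m a ->
    forall j, a j 0 != 0 -> dot u (zmx R (col j M)) = 0.
  case=> Py hy a0 ya j aj; have := hy v Pv; rewrite ya dotDr dot_mul_cols => h.
  have /eqP : \sum_j - (dot u (zmx R (col j M)) * a j 0) = 0.
    apply/eqP; rewrite eq_le sumr_ge0 => [|i _]; last first.
      by have := uM0 i; have := a0 i; nra.
    by rewrite sumrN; lra.
  rewrite psumr_eq0 => [/allP/(_ j (mem_index_enum _))|i _]; last first.
    by have := uM0 i; have := a0 i; nra.
  by rewrite oppr_eq0 mulf_eq0 (negPf aj) orbF => /eqP.
have span1 y z : face P u y -> face P u z -> exists s t : R,
    [/\ y - v = s *: D, z - v = t *: D & D != 0].
  move=> Fy Fz.
  have lin p : face P u p -> exists w : R, p - x0 = w *: D.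
    move=> /spanD [w ->]; exists (w 0 0); rewrite addrC addKr.
    by rewrite {1}[w]mx11_scalar mul_mx_scalar.
  have [a ya] := lin _ Fy; have [b zb] := lin _ Fz; have [c vc] := lin _ Fv.
  exists (a - c), (b - c); split.
  - by rewrite scalerBl -ya -vc opprB addrA subrK.
  - by rewrite scalerBl -zb -vc opprB addrA subrK.
  by apply/eqP => Dz; move: rD; rewrite Dz mxrank0.
have [Px _] := Fx; have [a a0 xa] := sub x Px.
have [j aj] : exists j, a j 0 != 0.
  apply: contrapT => h; case/eqP: xv; rewrite xa.
  rewrite (_ : a = 0) ?mulmx0 ?addr0 //; apply/colP => j; rewrite mxE.
  by apply: contrapT => /eqP e; apply: h; exists j.
have uj := zer x a Fx a0 xa j aj.
exists j; apply: Fray => // y Fy; have [Py _] := Fy; split=> //.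
have [t t0 Pt] := edg j.
have Ft : face P u (v + t *: zmx R (col j M)).
  by split=> // z Pz; rewrite dotDr dotZr uj mulr0 addr0; case: Fv => _; apply.
have [s [r [ys tr D0]]] := span1 _ _ Fy Ft.
have r0 : r != 0.
  apply/eqP => e; move: tr; rewrite e scale0r addrC addKr => /eqP.
  by rewrite scaler_eq0 gt_eqF //= (negPf (zmx_col_neq0 _ uM)).
have yE : y = v + (s / r * t) *: zmx R (col j M).
  move: tr; rewrite addrC addKr => tr.
  by rewrite -scalerA tr scalerA divfK // -ys addrC subrK.
exists (s / r * t) => //.
have := corner_coordf j cr Py; rewrite {1}yE dotDr dotZr dot_coordf_col // eqxx.
by rewrite mulr1 lerDl.
Qed.

End Corner.

Section SmoothOfCorners.
Variables (R : realType) (n : nat).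
Implicit Types (P : set 'cV[R]_n) (M : 'M[int]_n).

Lemma ray_edge_inj P v M : corner P v M -> injective (ray_edge P v M).
Proof.
move=> [_ uM _ edg] j l e; have [t t0 Pt] := edg j.
have : ray_edge P v M j (v + t *: zmx R (col j M)).
  by split=> //; exists t; rewrite // ltW.
rewrite e => -[_ [s _ /addrI /(congr1 (dot (zmx R (coordf M j))))]].
rewrite !dotZr !dot_coordf_col // eqxx mulr1; case: eqVneq => // _ /eqP.
by rewrite mulr0 gt_eqF.
Qed.

Lemma smooth_of_corners P : polytope P -> P !=set0 ->
  (forall v, vertex P v -> exists M, corner P v M) -> smooth P.
Proof.
move=> pP nP hc.
have edge_vertex F : edge P F ->
    exists v M j, corner P v M /\ F = ray_edge P v M j.
  move=> eF; have nF : F !=set0 by case: eF => _ [x [? [Fx]]]; exists x.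
  have [v vv Fv] := face_has_vertex pP eF.1 nF; have [M cM] := hc v vv.
  by have [j Fj] := edge_ray cM eF Fv; exists v, M, j.
have ray_dir v M F (w : 'cV[int]_n) : corner P v M -> edge P F -> F v ->
    forall t : R, 0 < t -> F (v + t *: zmx R w) -> primitive w ->
    exists j, w = col j M /\ F = ray_edge P v M j.
  move=> cM eF Fv t t0 Ft pw; have [k Fk] := edge_ray cM eF Fv; exists k.
  split=> //; move: Ft; rewrite Fk => -[_ [a a0 /addrI tw]].
  have uM := corner_unit cM.
  have wE : zmx R w = (a / t) *: zmx R (col k M).
    by rewrite mulrC -scalerA -tw scalerA mulVf ?lt0r_neq0 // scale1r.
  have := congr1 (dot (zmx R (coordf M k))) wE.
  rewrite dotZr dot_coordf_col // eqxx mulr1 dot_zmx => sE.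
  apply: (primitive_scale pw (s := ((coordf M k)^T *m w) 0 0)).
    by apply: (@zmx_inj R); rewrite zmxZ sE.
  by rewrite -(ler_int R) sE divr_ge0 // ltW.
split=> //.
- have [v vv _] := polytope_max 0 pP nP; have [M cM] := hc v vv.
  have [Pv uM sub edg] := cM.
  have /choice [t ht] : forall j, exists t : R,
      0 < t /\ P (v + t *: zmx R (col j M)).
    by move=> j; have [t] := edg j; exists t.
  pose D := zmx R M *m diag_mx (\row_j t j).
  have uD : D \in unitmx.
    rewrite unitmx_mul zmx_unitmx // unitmxE det_diag unitfE prodf_seq_neq0.
    by apply/allP => j _; rewrite mxE lt0r_neq0 //; case: (ht j).
  exists v, D; split=> //.
  - move=> j; rewrite (_ : col j D = t j *: zmx R (col j M));
      first by case: (ht j).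
    by apply/colP => i; rewrite /D mul_mx_diag !mxE mulrC.
  - exact: mxrank_unit.
  by move=> x _; exists (invmx D *m (x - v)); rewrite mulKVmx // addrC subrK.
- move=> v vv; have [M cM] := hc v vv.
  have -> : [set F | edge P F /\ F v] = ray_edge P v M @` [set: 'I_n].
    apply/seteqP; split=> [F [eF Fv]|_ [j _ <-]].
      by have [j ->] := edge_ray cM eF Fv; exists j.
    split; first exact: ray_edgeP.
    by split; [exact: corner_in cM|exists 0; rewrite // scale0r addr0].
  apply: card_eq_trans (inj_card_eq _) _.
    by move=> j l _ _; apply: ray_edge_inj.
  by rewrite card_eq_sym card_II.
- move=> F /edge_vertex [v [M [j [cM ->]]]]; exists (col j M).
    have := zmx_col_neq0 R j (corner_unit cM); apply: contra_neq => ->.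
    by rewrite zmx0.
  move=> x y [_ [a _ ->]] [_ [b _ ->]]; exists (b - a).
  by rewrite scalerBl opprD addrACA subrr add0r.
move=> v vv; have [M cM] := hc v vv; exists M; first exact: corner_unit cM.
move=> w; split=> [[pw [F [eF Fv [t t0 Ft]]]]|[j ->]].
  have [j] : exists j, w = col j M /\ F = ray_edge P v M j.
    by apply: ray_dir Ft pw => //.
  by case=> ->; exists j.
split; first exact: primitive_col (corner_unit cM).
exists (ray_edge P v M j); split; first exact: ray_edgeP.
  by split; [exact: corner_in cM|exists 0; rewrite // scale0r addr0].
by have [t t0 Pt] := corner_edge cM j; exists t => //; split=> //;
  exists t => //; rewrite ltW.
Qed.

(** Every edge has a vertex, so that the number of edges at a vertex, their
    rationality and the bases of their directions can be read off the
    corners. *)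
Lemma lattice_smoothP P : lattice_smooth P <->
  [/\ polytope P, P !=set0
    & forall v, vertex P v -> lattice v /\ exists M, corner P v M].
Proof.
split=> [[sP lP]|[pP nP h]].
  split; first by case: sP.
    by case: sP => _ [x [? [Px _ _ _]]] _ _ _; exists x.
  by move=> v vv; split; [exact: lP|exact: smooth_corner].
split; last by move=> v /h [].
by apply: smooth_of_corners => // v /h [].
Qed.

End SmoothOfCorners.

(** * Products and combinatorial equivalence *)

Section Faces.
Variable R : realType.

Lemma face_prod k n (B : set 'cV[R]_k) (Q : set 'cV[R]_n) u w :
  face (prod_set B Q) (col_mx u w) = prod_set (face B u) (face Q w).
Proof.
apply/seteqP; split=> [_ [[x Bx [y Qy <-]] h]|_ [x [Bx hx] [y [Qy hy] <-]]].
  exists x; last exists y => //.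
    split=> // x' Bx'; have := h (col_mx x' y); rewrite !dot_col_mx lerD2r.
    by apply; exists x' => //; exists y.
  split=> // y' Qy'; have := h (col_mx x y'); rewrite !dot_col_mx lerD2l.
  by apply; exists x => //; exists y'.
split; first by exists x => //; exists y.
move=> _ [x' Bx' [y' Qy' <-]]; rewrite !dot_col_mx.
by apply: lerD; [apply: hx|apply: hy].
Qed.

Lemma vertex_prod k n (B : set 'cV[R]_k) (Q : set 'cV[R]_n) x y :
  vertex B x -> vertex Q y -> vertex (prod_set B Q) (col_mx x y).
Proof.
move=> /vertexP [u eu] /vertexP [w ew]; apply/vertexP; exists (col_mx u w).
rewrite face_prod eu ew; apply/seteqP; split=> [_ [_ -> [_ -> <-]]//|_ ->].
by exists x => //; exists y.
Qed.

(** The face matched with a vertex v of P contains a vertex of the product,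
    which is itself the image of a face inside the vertex v, and this is v. *)
Lemma comb_equiv_prod_vertices l k n (P : set 'cV[R]_l) (B : set 'cV[R]_k)
    (Q : set 'cV[R]_n) :
    polytope B -> polytope Q -> comb_equiv P (prod_set B Q) ->
  exists g : 'cV[R]_l -> 'cV[R]_k * 'cV[R]_n,
    (forall v, vertex P v -> vertex B (g v).1 /\ vertex Q (g v).2) /\
    (forall v w, vertex P v -> vertex P w -> g v = g w -> v = w).
Proof.
move=> pB pQ [f [[fim finj fsurj] fsub]].
have P0 : faces P set0 by left.
have f0 : f set0 = set0.
  have [|G fG fG0] := fsurj set0; first by left.
  by apply/seteqP; split=> //; rewrite -fG0; apply/fsub.
have ne v : vertex P v -> f [set v] !=set0.
  move=> vv; apply: contrapT => h; have : [set v] v by [].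
  suff -> : [set v] = set0 by [].
  apply: finj; rewrite ?inE // f0; apply/seteqP; split=> // x fx.
  by case: h; exists x.
have pick v : exists xy : 'cV[R]_k * 'cV[R]_n, vertex P v ->
    [/\ vertex B xy.1, vertex Q xy.2 & f [set v] (col_mx xy.1 xy.2)].
  have [vv|nv] := pselect (vertex P v); last by exists (0, 0).
  have nfv := ne v vv; have := fim _ vv => -[e|[u eu]].
    by move: nfv; rewrite e => -[].
  move: eu; rewrite -[u]vsubmxK face_prod => eu; case: nfv => z; rewrite {1}eu.
  case=> x [Bx hx] [y [Qy hy] _].
  have [x' vx' fx'] := polytope_max (usubmx u) pB (ex_intro _ x Bx).
  have [y' vy' fy'] := polytope_max (dsubmx u) pQ (ex_intro _ y Qy).
  by exists (x', y') => _; split=> //; rewrite eu; exists x' => //; exists y'.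
have [g hg] := choice pick; exists g; split=> [v /hg []//|v w vv vw e].
have [vx vy fv] := hg v vv; have [_ _ fw] := hg w vw.
have [G fG eG] := fsurj _ (vertex_prod vx vy).
have Gv : G `<=` [set v] by apply/fsub => //; rewrite eG => _ ->.
have Gw : G `<=` [set w] by apply/fsub => //; rewrite eG => _ ->; rewrite e.
have [z Gz] : G !=set0.
  apply: contrapT => h; have G0 : G = set0.
    by apply/seteqP; split=> // x Gx; case: h; exists x.
  have : [set col_mx (g v).1 (g v).2] (col_mx (g v).1 (g v).2) by [].
  by rewrite -eG G0 f0.
by rewrite -(Gv z Gz) (Gw z Gz).
Qed.

End Faces.

Section CombEquiv.
Variable R : realType.

(** Inclusion of faces is inclusion of their vertices.  So a change of
    functionals tau that preserves which listed points are exposed induces an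
    isomorphism of face lattices, with inverse induced by tau'. *)
Lemma comb_equiv_of_vertices l k (P : set 'cV[R]_l) (P' : set 'cV[R]_k)
    (I : Type)
    (D : set I) (pt : I -> 'cV[R]_l) (pt' : I -> 'cV[R]_k)
    (tau : 'cV[R]_l -> 'cV[R]_k) (tau' : 'cV[R]_k -> 'cV[R]_l) :
    polytope P -> polytope P' -> P !=set0 -> P' !=set0 ->
    (forall w, vertex P w -> exists2 i, D i & w = pt i) ->
    (forall w, vertex P' w -> exists2 i, D i & w = pt' i) ->
    (forall u i, D i -> face P u (pt i) <-> face P' (tau u) (pt' i)) ->
    (forall u i, D i -> face P (tau' u) (pt i) <-> face P' u (pt' i)) ->
  comb_equiv P P'.
Proof.
move=> pP pP' nP nP' vP vP' ht ht'.
have sub d (S : set 'cV[R]_d) (q : I -> 'cV[R]_d) u u' : polytope S ->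
    (forall w, vertex S w -> exists2 i, D i & w = q i) ->
    (face S u `<=` face S u') <->
      (forall i, D i -> face S u (q i) -> face S u' (q i)).
  move=> pS vS; split=> [h i _ /h //|h]; apply: face_ind => //.
    exact: (face_convex (polytope_convex pS)).
  by move=> v vv; have [i Di ->] := vS v vv; apply: h.
have ne d (S : set 'cV[R]_d) u : polytope S -> S !=set0 -> face S u <> set0.
  by move=> pS nS e; have [v _] := polytope_max u pS nS; rewrite e.
have subt u u' : (face P u `<=` face P u') <->
    (face P' (tau u) `<=` face P' (tau u')).
  rewrite (sub _ _ pt) // (sub _ _ pt') //; split=> h i Di.
    by rewrite -!ht //; apply: h.
  by rewrite !ht //; apply: h.
pose f (F : set 'cV[R]_l) :=
  [set z | exists2 u, F = face P u & face P' (tau u) z].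
have fE u : f (face P u) = face P' (tau u).
  apply/seteqP; split=> [z [u' e] |z Fz]; last by exists u.
  by apply: ((subt u' u).1 _ z); rewrite e.
have f0 : f set0 = set0.
  by apply/seteqP; split=> // z [u /esym e]; case: (ne _ _ _ pP nP e).
have fsub F G : faces P F -> faces P G -> (F `<=` G <-> f F `<=` f G).
  case=> [->|[u ->]]; first by rewrite f0; split=> _; apply: sub0set.
  case=> [->|[u' ->]]; last by rewrite !fE; apply: subt.
  rewrite f0 fE; split=> h;
    [case: (ne _ _ u pP nP)|case: (ne _ _ (tau u) pP' nP')].
    by apply/seteqP; split.
  by apply/seteqP; split.
exists f; split=> //; split.
- by move=> _ [->|[u ->]]; [left; rewrite f0|right; exists (tau u); rewrite fE].
- move=> F G; rewrite !inE => fF fG e; apply/seteqP.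
  by split; apply/fsub => //; rewrite e.
move=> _ [->|[u ->]]; first by exists set0; [left|].
exists (face P (tau' u)); first by right; exists (tau' u).
rewrite fE; apply/seteqP; split; rewrite (sub _ _ pt') // => i Di.
  by rewrite -ht // ht'.
by rewrite -ht // ht'.
Qed.

End CombEquiv.

(** * Support functions of the fibres of a family *)

Section Slice.
Variable R : realType.

Lemma dot_split k n (u x : 'cV[R]_(k + n)) :
  dot u x = dot (usubmx u) (usubmx x) + dot (dsubmx u) (dsubmx x).
Proof. by rewrite -dot_col_mx !vsubmxK. Qed.

Definition slice k n (P : set 'cV[R]_(k + n)) (x : 'cV[R]_k) : set 'cV[R]_n :=
  [set y | P (col_mx x y)].

Lemma slice_polytope k n (P : set 'cV[R]_(k + n)) x :
  polytope P -> polytope (slice P x).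
Proof.
case=> -[m [A [c eP]]] [M hM]; split; last first.
  by exists M => y /hM h i; have := h (rshift _ i); rewrite col_mxEd.
exists m, (rsubmx A), (c - lsubmx A *m x).
have key y i : (A *m col_mx x y) i 0 = (lsubmx A *m x) i 0 + (rsubmx A *m y) i
    0.
  by rewrite -{1}[A]hsubmxK mul_row_col mxE.
have cE i : (c - lsubmx A *m x) i 0 = c i 0 - (lsubmx A *m x) i 0.
  by rewrite mxE [X in _ + X]mxE.
rewrite /slice eP; apply/seteqP; split=> y h i; have := h i;
  by rewrite key cE; lra.
Qed.

(** If y satisfied all the inequalities without lying in T, some u would
    separate it from T.  Let v maximize u over T and let w be the vertex of the
    reference polyhedron with the same normal cone: the rows active at w allow a
    small step from w along y - v, although u is maximal at w. *)
Lemma polyhedron_of_cones n m (A : 'M[R]_(m, n)) c (h : 'cV[R]_m)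
    (T : set 'cV[R]_n) :
    polytope T -> T !=set0 -> vertex_cones T = vertex_cones (polyhedron A c) ->
    (forall y i, T y -> (A *m y) i 0 <= h i 0) ->
    (forall i, exists2 y, T y & (A *m y) i 0 = h i 0) ->
  T = polyhedron A h.
Proof.
move=> pT nT eT Th Tm; apply/seteqP; split=> [y Ty i|y Ay]; first exact: Th.
have [[m0 [A0 [c0 eT0]]] _] := pT; rewrite eT0 => i; rewrite leNgt.
apply/negP => yi; have [v vv [Tv vmax]] := polytope_max (row i A0)^T pT nT.
have uv : dot (row i A0)^T v < dot (row i A0)^T y.
  rewrite -!dot_row; apply: le_lt_trans yi.
  by move: Tv; rewrite eT0; apply.
have : vertex_cones T (normal_cone T [set v]) by exists v.
rewrite eT => -[w vw ew]; have Pw := vertex_in vw.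
have [|t t0 Pt] := @polyhedron_step _ _ _ A c w (y - v) Pw.
  move=> j wj; have : normal_cone T [set v] (row j A)^T.
    rewrite -ew normal_cone1 // => z Pz; rewrite -!dot_row wj; exact: Pz.
  rewrite normal_cone1 // => hj; have [z Tz zj] := Tm j.
  have := hj z Tz; rewrite -!dot_row zj mulmxBE; have := Ay j; lra.
have : normal_cone (polyhedron A c) [set w] (row i A0)^T.
  by rewrite ew; apply/face_normal_cone1.
rewrite normal_cone1 // => /(_ _ Pt); rewrite dotDr dotZr dotBr; nra.
Qed.

End Slice.

(** A bundle with a smooth total space, in coordinates in which the projection
    is the first block. *)
Section Family.
Variables (R : realType) (k n : nat).
Variables (P : set 'cV[R]_(k + n)) (B : set 'cV[R]_k) (Q : set 'cV[R]_n).
Hypotheses (pP : polytope P) (pB : polytope B) (pQ : polytope Q).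
Hypothesis nP : P !=set0.
Hypothesis cornP : forall w, vertex P w -> lattice w /\ exists N, corner P w N.
Hypothesis cornQ : forall q, vertex Q q -> exists M, corner Q q M.
Hypothesis projB : forall x, B x <-> exists y, P (col_mx x y).
Hypothesis conesP : forall x, B x -> vertex_cones (slice P x) = vertex_cones Q.
Hypothesis overB : forall w, vertex P w -> vertex B (usubmx w).

Implicit Types (w : 'cV[R]_(k + n)) (N : 'M[int]_(k + n)) (r : 'cV[int]_n).

Lemma vertex_slice w : vertex P w -> vertex (slice P (usubmx w)) (dsubmx w).
Proof.
move=> vw; have [u eu] := (vertexP _ _).1 vw; apply/vertexP.
have [Pw uw] : face P u w by rewrite eu.
exists (dsubmx u); apply/seteqP; split=> [y [Sy hy]|_ ->].
  suff : face P u (col_mx (usubmx w) y).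
    by rewrite eu => <-; rewrite col_mxKd.
  split=> // z Pz; apply: le_trans (uw z Pz) _.
  have := hy (dsubmx w); rewrite /slice /= vsubmxK => /(_ Pw).
  by rewrite !dot_split col_mxKu col_mxKd lerD2l.
split; first by rewrite /slice /= vsubmxK.
by move=> y /uw; rewrite !dot_split col_mxKu col_mxKd lerD2l.
Qed.

(** The endpoint of an edge leaving the fibre projects to another point of B,
    where mu is smaller. *)
Lemma base_edge w N (mu : 'cV[R]_k) l : vertex P w -> corner P w N ->
    face B mu = [set usubmx w] -> usubmx (col l N) != 0 ->
  dot mu (zmx R (usubmx (col l N))) < 0.
Proof.
move=> vw cN emu al0; have [t t0 Pt] := corner_edge cN l.
have Bt : B (usubmx w + t *: zmx R (usubmx (col l N))).
  apply/projB; exists (dsubmx w + t *: zmx R (dsubmx (col l N))).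
  by rewrite -add_col_mx -scale_col_mx -zmx_col_mx !vsubmxK.
have [Bw bmax] : face B mu (usubmx w) by rewrite emu.
have /ltW lt0 := t0; have := bmax _ Bt; rewrite dotDr dotZr => le0.
rewrite lt_neqAle; apply/andP; split; last by nra.
apply/eqP => mu0.
have : face B mu (usubmx w + t *: zmx R (usubmx (col l N))).
  by split=> // z /bmax; rewrite dotDr dotZr mu0 mulr0 addr0.
rewrite emu => /= /eqP; rewrite addrC -subr_eq0 addrK scaler_eq0 gt_eqF //=.
rewrite -(zmx0 R k 1) => /eqP /zmx_inj e; by rewrite e eqxx in al0.
Qed.

(** Only the generators inside the fibre contribute to it, because the others
    decrease mu; if y were orthogonal to them, the normal cone of the fibre
    would contain a line, but a vertex of Q has a pointed normal cone. *)
Lemma fibre_span w N (y : 'cV[R]_n) : vertex P w -> corner P w N ->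
    (forall l, usubmx (col l N) = 0 -> dot y (zmx R (dsubmx (col l N))) = 0) ->
  y = 0.
Proof.
move=> vw cN hy; have Pw := vertex_in vw; have vB := overB vw.
have [mu emu] := (vertexP _ _).1 vB.
have Bw := vertex_in vB.
have : vertex_cones Q (normal_cone (slice P (usubmx w)) [set dsubmx w]).
  by rewrite -(conesP Bw); exists (dsubmx w) => //; apply: vertex_slice.
case=> q vq eq; have [M cM] := cornQ vq.
have orth z : slice P (usubmx w) z -> dot y (z - dsubmx w) = 0.
  rewrite /slice /= => /(corner_sub cN) [a a0 ea].
  have up : \sum_l dot mu (zmx R (usubmx (col l N))) * a l 0 = 0.
    have : dot (col_mx mu 0) (col_mx (usubmx w) z) = dot (col_mx mu 0) w.
      by rewrite !dot_split !col_mxKu !col_mxKd !(dotC 0) !dot0r.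
    rewrite ea dotDr dot_mul_cols =>
      /(congr1 (fun s => s - dot (col_mx mu 0) w)).
    rewrite subrr addrC addKr => e; rewrite -[RHS]e; apply: eq_bigr => l _;
      congr (_ * _).
    by rewrite -[col l N in RHS]vsubmxK zmx_col_mx dot_col_mx (dotC 0) dot0r
      addr0.
  have al l : usubmx (col l N) != 0 -> a l 0 = 0.
    move=> nl; have /eqP := congr1 -%R up; rewrite oppr0 -sumrN psumr_eq0.
      move=> /allP /(_ l (mem_index_enum _)) /=; rewrite oppr_eq0 mulf_eq0.
      by rewrite lt_eqF ?(base_edge vw cN emu nl) //= => /eqP.
    move=> j _; have := a0 j; have [->|nj] := eqVneq (usubmx (col j N)) 0.
      by rewrite zmx0 dot0r mul0r oppr0.
    by have := base_edge vw cN emu nj; nra.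
  have : dot (col_mx 0 y) (col_mx (usubmx w) z) - dot (col_mx 0 y) w = dot y
      (z - dsubmx w).
    by rewrite !dot_split !col_mxKu !col_mxKd dotBr !(dotC 0) !dot0r !add0r.
  move=> <-; rewrite ea dotDr addrC addKr dot_mul_cols big1 // => l _.
  have [e|nl] := eqVneq (usubmx (col l N)) 0; last by rewrite al ?mulr0.
  by rewrite -[col l N]vsubmxK zmx_col_mx dot_col_mx e zmx0 dot0r add0r hy //
    mul0r.
have cone s : normal_cone (slice P (usubmx w)) [set dsubmx w] (s *: y).
  apply/normal_cone1; first by rewrite /slice /= vsubmxK.
  by move=> z /orth; rewrite dotBr !dotZl => e; nra.
have yM j : dot y (zmx R (col j M)) = 0.
  have := cone 1; have := cone (-1); rewrite -eq.
  move=> /(corner_cone _ cM) /(_ j) h1 /(corner_cone _ cM) /(_ j).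
  by move: h1; rewrite !dotZl; lra.
apply/colP => i; rewrite mxE -dot_delta dotC.
have uM := corner_unit cM.
rewrite -[delta_mx i 0]mul1mx -(zmxK R uM) -mulmxA dot_mul_cols big1 // => j _.
by rewrite yM mul0r.
Qed.

(** The functional is prescribed on the basis N: equal to r on the generators in
    the fibre and to 0 on the others.  It is integral as N is unimodular, and it
    extends r because the generators in the fibre span R^n. *)
Lemma local_functional w N r : vertex P w -> corner P w N ->
  exists lam : 'cV[int]_k, forall l, usubmx (col l N) != 0 ->
    dot (zmx R (col_mx lam r)) (zmx R (col l N)) = 0.
Proof.
move=> vw cN; have uN := corner_unit cN.
pose rho := \row_l
  (if usubmx (col l N) == 0 then (r^T *m dsubmx (col l N)) 0 0 else 0).
pose gam := (rho *m invmx N)^T.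
have gamE l : dot (zmx R gam) (zmx R (col l N)) = (rho 0 l)%:~R.
  rewrite dot_zmx trmxK; congr (_%:~R).
  by rewrite colE mulmxA mulmxKV // -colE mxE.
have gr : dsubmx gam = r.
  apply: (@zmx_inj R); apply/eqP; rewrite -subr_eq0; apply/eqP.
  apply: (fibre_span vw cN) => l al.
  have := gamE l; rewrite mxE al eqxx -[gam]vsubmxK -[col l N]vsubmxK.
  rewrite !zmx_col_mx dot_col_mx al col_mxKd zmx0 dot0r add0r => e.
  by rewrite ?col_mxKd dotDl dotNl e dot_zmx subrr.
exists (usubmx gam) => l nl; rewrite -gr vsubmxK gamE mxE (negPf nl) //.
Qed.

Lemma local_support w N (g : 'cV[R]_(k + n)) : vertex P w -> corner P w N ->
    (forall y, slice P (usubmx w) y ->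
      dot (dsubmx g) y <= dot (dsubmx g) (dsubmx w)) ->
    (forall l, usubmx (col l N) != 0 -> dot g (zmx R (col l N)) = 0) ->
  face P g w.
Proof.
move=> vw cN hr hg; apply/face_normal_cone1/(corner_cone _ cN) => l.
have [al|/hg ->//] := eqVneq (usubmx (col l N)) 0.
have [t t0 Pt] := corner_edge cN l.
have := hr (dsubmx w + t *: zmx R (dsubmx (col l N))).
rewrite dotDr dotZr => h; rewrite -[col l N]vsubmxK zmx_col_mx dot_split.
rewrite col_mxKu col_mxKd al zmx0 dot0r add0r.
have {}h := h _; suff : slice P (usubmx w)
    (dsubmx w + t *: zmx R (dsubmx (col l N))).
  by move/h; nra.
rewrite /slice /= (_ : col_mx _ _ = w + t *: zmx R (col l N)) //.
rewrite -[w in RHS]vsubmxK -[col l N in RHS]vsubmxK zmx_col_mx scale_col_mx.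
by rewrite add_col_mx al zmx0 scaler0 addr0.
Qed.

(** Let w0 maximize r over P, let gam = (lam, r) be the local functional there
    and F the face that it exposes.  At every vertex w of F the local
    functional is gam again ([out]), so that no edge that leaves the fibre at w
    leaves F.  A vertex w of F maximizing mu over F then maximizes mu over P.
    Choosing mu to expose a vertex of B shows that F projects onto B. *)
Lemma affine_support r : exists (lam : 'cV[int]_k) (kap : int),
  (forall x y, P (col_mx x y) ->
    dot (zmx R r) y <= kap%:~R + dot (zmx R lam) x) /\
  (forall x, B x -> exists2 y, P (col_mx x y) &
    dot (zmx R r) y = kap%:~R + dot (zmx R lam) x).
Proof.
have [w0 vw0 [_ max0]] := polytope_max (col_mx 0 (zmx R r)) pP nP.
have [lat0 [N0 cN0]] := cornP vw0; have uN0 := corner_unit cN0.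
have [lam hlam] := local_functional r vw0 cN0.
pose gam := zmx R (col_mx lam r).
have gamd : dsubmx gam = zmx R r by rewrite /gam zmx_col_mx col_mxKd.
have gam_fibre (g : 'cV[R]_(k + n)) (N : 'M[int]_(k + n)) l :
    dsubmx g = zmx R r ->
    usubmx (col l N) = 0 ->
    dot g (zmx R (col l N)) = dot (zmx R r) (zmx R (dsubmx (col l N))).
  move=> gd al; rewrite dot_split gd -{1 2}[col l N]vsubmxK al zmx_col_mx.
  by rewrite col_mxKu col_mxKd zmx0 dot0r add0r.
have F0 : face P gam w0.
  apply: (local_support vw0 cN0) => // y Sy; rewrite gamd.
  have := max0 _ Sy; rewrite !dot_split !col_mxKu !col_mxKd.
  by rewrite !(dotC 0) !dot0r !add0r.
have out w N : vertex P w -> corner P w N -> face P gam w ->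
    forall l, usubmx (col l N) != 0 -> dot gam (zmx R (col l N)) = 0.
  move=> vw cN [Pw maxw].
  have [lam1 hlam1] := local_functional r vw cN.
  pose gam1 := zmx R (col_mx lam1 r).
  have gam1d : dsubmx gam1 = zmx R r by rewrite /gam1 zmx_col_mx col_mxKd.
  have gw l : dot gam (zmx R (col l N)) <= 0.
    by apply: ((corner_cone _ cN).1 _ l); apply/face_normal_cone1.
  (* gam and gam1 agree on the generators at w in the fibre, gam1 vanishes on
     the others, and w' - w uses only generators on which gam vanishes *)
  have same w' : face P gam w' -> dot gam1 w' = dot gam1 w.
    move=> [Pw' maxw']; have [a a0 ea] := corner_sub cN Pw'.
    have : dot gam w' = dot gam w by apply/eqP; rewrite eq_le maxw // maxw'.
    rewrite ea !dotDr !dot_mul_cols => e.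
    have /eqP : \sum_l - (dot gam (zmx R (col l N)) * a l 0) = 0 by rewrite
      sumrN; lra.
    rewrite psumr_eq0 => [/allP az|l _]; last by have := gw l; have := a0 l;
      nra.
    rewrite big1 ?addr0 // => l _.
    have [al|/hlam1 ->] := eqVneq (usubmx (col l N)) 0; last by rewrite mul0r.
    rewrite (gam_fibre gam1) // -(gam_fibre gam) //.
    by have := az l (mem_index_enum _); rewrite oppr_eq0 => /eqP.
  have e01 l : dot (gam1 - gam) (zmx R (col l N0)) = 0.
    rewrite dotDl dotNl.
    have [al|nl] := eqVneq (usubmx (col l N0)) 0.
      by rewrite !gam_fibre // subrr.
    rewrite (hlam l nl) subr0.
    have [t t0 Pt] := corner_edge cN0 l.
    have Ft : face P gam (w0 + t *: zmx R (col l N0)).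
      by split=> // z Pz; rewrite dotDr dotZr (hlam l nl) mulr0 addr0;
        apply F0.2.
    have := same _ Ft; rewrite -(same _ F0) dotDr dotZr => e.
    have /eqP : t * dot gam1 (zmx R (col l N0)) = 0 by lra.
    by rewrite mulf_eq0 gt_eqF //= => /eqP.
  have gam10 : gam1 = gam.
    apply/eqP; rewrite -subr_eq0; apply/eqP/colP => i; rewrite [RHS]mxE.
    rewrite -dot_delta dotC -[delta_mx i 0]mul1mx -(zmxK R uN0) -mulmxA.
    by rewrite dot_mul_cols big1 // => j _; rewrite e01 mul0r.
  by move=> l nl; rewrite -gam10; apply: hlam1.
have [kap kapE] := dot_lattice (col_mx lam r) lat0; rewrite -/gam in kapE.
exists (- lam), kap; split=> [x y Pxy|].
  have := F0.2 _ Pxy; rewrite kapE dot_split gamd col_mxKu col_mxKd.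
  by rewrite /gam zmx_col_mx col_mxKu zmxN dotNl; lra.
suff : forall x, B x -> [set x | exists y, face P gam (col_mx x y)] x.
  move=> h x /h [y [Pxy my]]; exists y => //.
  have : dot gam (col_mx x y) = kap%:~R.
    by rewrite -kapE; apply/eqP; rewrite eq_le my ?F0.2 //; case: F0.
  rewrite dot_split gamd col_mxKu col_mxKd /gam zmx_col_mx col_mxKu.
  by rewrite zmxN dotNl; lra.
apply: polytope_ind => //.
  move=> x x' t [y Fy] [y' Fy'] t01; exists ((1 - t) *: y + t *: y').
  rewrite -add_col_mx -!scale_col_mx.
  exact: (face_convex (polytope_convex pP)).
move=> z vz; have [mu emu] := (vertexP _ _).1 vz.
have [w [vw Fw maxw]] := face_max gam (col_mx mu 0) pP nP.
have [_ [N cN]] := cornP vw.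
suff zw : z = usubmx w by exists (dsubmx w); rewrite zw vsubmxK.
have : face P (col_mx mu 0) w.
  apply/face_normal_cone1/(corner_cone _ cN) => l.
  have [al|nl] := eqVneq (usubmx (col l N)) 0.
    rewrite dot_split -[col l N]vsubmxK zmx_col_mx !col_mxKu !col_mxKd al zmx0.
    by rewrite dot0r add0r dotC dot0r.
  have [t t0 Pt] := corner_edge cN l.
  have Ft : face P gam (w + t *: zmx R (col l N)).
    by split=> // u Pu; rewrite dotDr dotZr (out _ _ vw cN Fw l nl) mulr0 addr0;
      apply Fw.2.
  by have := maxw _ Ft; rewrite dotDr dotZr; nra.
case=> Pw muw; have [Bz _] : face B mu z by rewrite emu.
have : face B mu (usubmx w).
  split; first by apply/projB; exists (dsubmx w); rewrite vsubmxK.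
  move=> x /projB [y /muw]; rewrite !dot_split !col_mxKu !col_mxKd.
  by rewrite !(dotC 0) !dot0r !addr0.
by rewrite emu.
Qed.

End Family.

(** * Bundles in lattice coordinates *)

Section BundleCoordinates.
Variables (R : realType) (k n : nat).
Implicit Types (P : set 'cV[R]_(k + n)) (B : set 'cV[R]_k) (Q : set 'cV[R]_n).

(** The vertices of P over those of B are as many as the pairs of a vertex of B
    and a vertex of Q, and P has at most that many vertices. *)
Lemma vertices_over_base P B Q :
    polytope P -> polytope B -> polytope Q ->
    (forall x, B x <-> exists y, P (col_mx x y)) ->
    (forall x, B x -> vertex_cones (slice P x) = vertex_cones Q) ->
    (exists g : 'cV[R]_(k + n) -> 'cV[R]_k * 'cV[R]_n,
      (forall v, vertex P v -> vertex B (g v).1 /\ vertex Q (g v).2) /\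
      (forall v w, vertex P v -> vertex P w -> g v = g w -> v = w)) ->
  forall w, vertex P w -> vertex B (usubmx w).
Proof.
move=> pP pB pQ projB conesP [g [gv ginj]] w vw.
have vtx x y : vertex B x -> vertex (slice P x) y -> vertex P (col_mx x y).
  move=> vx vy; have [mu emu] := (vertexP _ _).1 vx.
  have [u eu] := (vertexP _ _).1 vy;
    have [Sy uy] : face (slice P x) u y by rewrite eu.
  have Fx : face B mu x by rewrite emu.
  have FP z : face P (col_mx mu 0) z <-> P z /\ usubmx z = x.
    split=> [[Pz hz]|[Pz zx]].
      split=> //; have : face B mu (usubmx z); last by rewrite emu.
      split; first by apply/projB; exists (dsubmx z); rewrite vsubmxK.
      move=> x' /projB [y' /hz]; rewrite !dot_split !col_mxKu !col_mxKd.
      by rewrite !(dotC 0) !dot0r !addr0.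
    split=> // z' Pz'; rewrite !dot_split !col_mxKu !col_mxKd !(dotC 0) !dot0r.
    rewrite !addr0 zx; apply: Fx.2; apply/projB.
    by exists (dsubmx z'); rewrite vsubmxK.
  apply: (@vertex_face _ _ _ (col_mx mu 0) (col_mx 0 u) _ pP).
  apply/seteqP; split=> [z [/FP [Pz zx] hz]|_ ->].
    have : face (slice P x) u (dsubmx z).
      split; first by rewrite /slice /= -zx vsubmxK.
      move=> y' Sy'; have := hz (col_mx x y').
      rewrite !dot_split !col_mxKu !col_mxKd !(dotC 0) !dot0r !add0r; apply.
      by apply/FP; rewrite col_mxKu.
    by rewrite eu /= -zx => <-; rewrite vsubmxK.
  split; first by apply/FP; rewrite col_mxKu.
  move=> z /FP [Pz zx]; rewrite !dot_split !col_mxKu !col_mxKd !(dotC 0) !dot0r.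
  by rewrite !add0r; apply: uy; rewrite /slice /= -zx vsubmxK.
have pick (xq : 'cV[R]_k * 'cV[R]_n) : exists y, vertex B xq.1 ->
    vertex Q xq.2 ->
    vertex (slice P xq.1) y /\
    normal_cone (slice P xq.1) [set y] = normal_cone Q [set xq.2].
  have [vx|nx] := pselect (vertex B xq.1); last by exists 0.
  have [vq|nq] := pselect (vertex Q xq.2); last by exists 0.
  have : vertex_cones Q (normal_cone Q [set xq.2]) by exists xq.2.
  by rewrite -(conesP _ (vertex_in vx)) => -[y vy <-]; exists y.
have [h hh] := choice pick.
have [VB hVB] := finite_vertices pB; have [VQ hVQ] := finite_vertices pQ.
have [VP hVP] := finite_vertices pP.
pose prods := [seq (x, q) | x <- undup VB, q <- undup VQ].
have uprods : uniq prods.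
  by apply: allpairs_uniq; rewrite ?undup_uniq // => -[? ?] [? ?] _ _ [-> ->].
have inprods xq : (xq \in prods) <-> vertex B xq.1 /\ vertex Q xq.2.
  rewrite -hVB -hVQ; split=> [/allpairsP [[x q] /= [+ + ->]]|[]].
    by rewrite !mem_undup.
  rewrite -(mem_undup VB) -(mem_undup VQ) => h1 h2.
  by apply/allpairsP; exists xq; split=> //; case: (xq).
pose lift := [seq col_mx xq.1 (h xq) | xq <- prods].
have ulift : uniq lift.
  rewrite map_inj_in_uniq // => -[x q] [x' q'] /inprods /= [vx vq].
  move=> /inprods /= [vx' vq'] /eq_col_mx [e]; subst x' => eh.
  have [_ e1] := hh (x, q) vx vq; have [_ e2] := hh (x, q') vx vq'.
  congr (_, _); apply: (vertex_cone_inj vq (vertex_in vq')).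
  by rewrite -e1 -e2 eh.
have sublift : {subset lift <= undup VP}.
  move=> z /mapP [xq /inprods [vx vq] ->]; rewrite mem_undup; apply/hVP.
  by apply: vtx => //; case: (hh xq vx vq).
have szP : (size (undup VP) <= size lift)%N.
  rewrite size_map -(size_map g); apply: uniq_leq_size.
    rewrite map_inj_in_uniq ?undup_uniq // => v v'; rewrite !mem_undup.
    by move=> /hVP vv /hVP vv'; apply: ginj.
  by move=> z /mapP [v]; rewrite mem_undup => /hVP /gv vv ->; apply/inprods.
have [_ eqP] := uniq_min_size ulift sublift szP.
have : w \in lift by rewrite eqP mem_undup; apply/hVP.
by case/mapP => xq /inprods [vx _] ->; rewrite col_mxKu.
Qed.

Lemma bundle_coordinates (i : {linear 'cV[R]_n -> 'cV[R]_(k + n)})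
    (p : {linear 'cV[R]_(k + n) -> 'cV[R]_k}) : unimodular_sequence i p ->
  exists T : 'M[int]_(k + n), [/\ T \in unitmx,
    forall y, i y = zmx R T *m col_mx 0 y &
    forall x y, p (zmx R T *m col_mx x y) = x].
Proof.
case=> U [V [W [[uU uV uW] hi hp]]].
pose D : 'M[int]_(k + n) := block_mx W 0 0 U.
have DE x y : zmx R D *m col_mx x y = col_mx (zmx R W *m x) (zmx R U *m y).
  have -> : zmx R D = block_mx (zmx R W) 0 0 (zmx R U).
    by rewrite /zmx map_block_mx !map_mx0.
  by rewrite mul_block_col !mul0mx addr0 add0r.
have VT x y : zmx R V *m (zmx R (invmx V *m D) *m col_mx x y) =
    col_mx (zmx R W *m x) (zmx R U *m y).
  by rewrite zmxM -!mulmxA DE !mulmxA zmxK // mul1mx.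
have Vinj (l : nat) (M : 'M[int]_l) (x y : 'cV[R]_l) : M \in unitmx ->
    zmx R M *m x = zmx R M *m y -> x = y.
  move=> uM /(congr1 (mulmx (zmx R (invmx M)))).
  by rewrite !mulmxA zmxVK // !mul1mx.
exists (invmx V *m D); split=> [|y|x y].
- rewrite unitmx_mul unitmx_inv uV /= unitmxE det_ublock unitrM.
  by rewrite -!unitmxE uW.
- by apply: (Vinj _ V) => //; rewrite hi VT mulmx0.
by apply: (Vinj _ W) => //; rewrite hp VT col_mxKu.
Qed.

End BundleCoordinates.

(** The total space in the coordinates given by T. *)
Section Pullback.
Variables (R : realType) (k n : nat).
Variables (P : set 'cV[R]_(k + n)) (T : 'M[int]_(k + n)).
Hypothesis uT : T \in unitmx.
Let P' : set 'cV[R]_(k + n) := [set w | P (zmx R T *m w)].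

Lemma pullback_polytope : polytope P -> polytope P'.
Proof.
case=> -[m [A [c eP]]] [M hM]; split.
  exists m, (A *m zmx R T), c; apply/seteqP.
  by rewrite /P' eP; split=> w h i; have := h i; rewrite mulmxA.
exists (\sum_i \sum_j `|zmx R (invmx T) i j| * M) => w Pw i.
rewrite -[w]mul1mx -(zmxVK R uT) -mulmxA mxE.
apply: le_trans (ler_norm_sum _ _ _) _.
have M0 : 0 <= M := le_trans (normr_ge0 _) (hM _ Pw i).
rewrite [leRHS](bigD1 i) //= ler_wpDr //.
  by apply: sumr_ge0 => a _; apply: sumr_ge0 => b _; rewrite mulr_ge0.
by apply: ler_sum => j _; rewrite normrM ler_wpM2l //; apply: hM.
Qed.

Lemma pullback_emb : P = emb (zmx R T) 0 P'.
Proof.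
apply/seteqP; split=> [z Pz|_ [w Pw <-]]; last by rewrite add0r.
exists (zmx R (invmx T) *m z); rewrite /P' /= mulmxA zmxK // mul1mx //.
by rewrite add0r.
Qed.

Lemma pullback_vertex w : vertex P' w <-> vertex P (zmx R T *m w).
Proof.
by have := vertex_emb (zmxVK R uT) 0 P' w; rewrite add0r -pullback_emb => ->.
Qed.

Lemma pullback_corner w N :
  corner P (zmx R T *m w) N -> corner P' w (invmx T *m N).
Proof.
case=> Pw uN sub edg; split=> //.
- by rewrite unitmx_mul unitmx_inv uT.
- move=> z Pz; have [a a0 ea] := sub _ Pz; exists a => //.
  rewrite zmxM -mulmxA -[z]mul1mx -[w in RHS]mul1mx -(zmxVK R uT) -!mulmxA.
  by rewrite ea mulmxDr.
move=> j; have [t t0 Pt] := edg j; exists t => //.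
rewrite /P' /= mulmxDr -scalemxAr -zmxM [T *m _](_ : _ = col j N) //.
by rewrite !colE !mulmxA mulmxV // mul1mx.
Qed.

End Pullback.

(** * Neat fibres lift Ewald points *)

Section Lifting.
Variables (R : realType) (n : nat) (Q : set 'cV[R]_n).

(** The segment from a point of the polyhedron to one that violates only
    constraint i meets the facet i. *)
Lemma irredundant_tight m (A : 'M[R]_(m, n)) c i : irredundant A c ->
  polyhedron A c !=set0 -> exists2 y, polyhedron A c y & (A *m y) i 0 = c i 0.
Proof.
move=> /(_ i) [x [hx xi]] [q Pq]; have qi := Pq i.
pose t := (c i 0 - (A *m q) i 0) / ((A *m x) i 0 - (A *m q) i 0).
have d0 : 0 < (A *m x) i 0 - (A *m q) i 0 by lra.
have t0 : 0 <= t by rewrite divr_ge0 ?subr_ge0 // ltW // -subr_gt0.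
have t1 : t <= 1 by rewrite ler_pdivrMr // mul1r lerD2r ltW.
have yE j : (A *m (q + t *: (x - q))) j 0 =
    (A *m q) j 0 + t * ((A *m x) j 0 - (A *m q) j 0).
  by rewrite mulmxDE mulmxZE mulmxBE.
have yi : (A *m (q + t *: (x - q))) i 0 = c i 0.
  by rewrite yE /t divfK ?lt0r_neq0 //; ring.
exists (q + t *: (x - q)) => // j.
have [->|ji] := eqVneq j i; first by rewrite yi.
by rewrite yE; have := hx j ji; have := Pq j; nra.
Qed.

(** The fibre over 0 is Q by the convention on bundles, so that the fibre over x
    is { y | A y <= c + L x } with L linear and integral, and those over v and
    - v are displacements of Q by opposite vectors. *)
Lemma neat_lift k (P : set 'cV[R]_(k + n)) (B : set 'cV[R]_k)
    (i : {linear 'cV[R]_n -> 'cV[R]_(k + n)})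
    (p : {linear 'cV[R]_(k + n) -> 'cV[R]_k}) :
    lattice_smooth Q -> neat Q -> lattice_smooth P -> bundle P B Q i p ->
  forall v, ewald B v -> exists2 z, ewald P z & p z = v.
Proof.
move=> /lattice_smoothP [pQ nQ cornQ0] neatQ /lattice_smoothP [pP nP cornP0].
move=> [_ pB _ cmb _ unim img fib zer] v [[vz vE] Bv BNv].
have [T [uT iE pE]] := bundle_coordinates unim.
pose P' := [set w | P (zmx R T *m w)].
have pP' : polytope P' by apply: pullback_polytope.
have zT z : z = zmx R T *m (zmx R (invmx T) *m z).
  by rewrite mulmxA zmxK // mul1mx.
have nP' : P' !=set0.
  by case: nP => z Pz; exists (zmx R (invmx T) *m z); rewrite /P' /= -zT.
have cornP w : vertex P' w -> lattice w /\ exists N, corner P' w N.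
  move=> /(pullback_vertex P uT) /cornP0 [lw [N cN]]; split.
    rewrite -[w]mul1mx -(zmxVK R uT) -mulmxA; exact: lattice_mul.
  by exists (invmx T *m N); apply: pullback_corner.
have cornQ q : vertex Q q -> exists M, corner Q q M by case/cornQ0.
have projB x : B x <-> exists y, P' (col_mx x y).
  rewrite -img; split=> [[z Pz <-]|[y Py]];
    last by exists (zmx R T *m col_mx x y).
  exists (dsubmx (zmx R (invmx T) *m z)); rewrite /P' /=.
  rewrite [z in p z]zT -[X in p (_ *m X)]vsubmxK pE vsubmxK -zT //.
pose E := zmx R T *m col_mx (0 : 'M[R]_(k, n)) 1%:M.
have LE : (row_mx 0 1%:M *m zmx R (invmx T)) *m E = 1%:M.
  rewrite /E -mulmxA (mulmxA (zmx R (invmx T))) zmxVK // mul1mx mul_row_col.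
  by rewrite mul0mx add0r mul1mx.
have TE (x : 'cV[R]_k) (y : 'cV[R]_n) :
    zmx R T *m col_mx x y = zmx R T *m col_mx x 0 + E *m y.
  by rewrite /E -mulmxA mul_col_mx mul0mx mul1mx -mulmxDr add_col_mx addr0
    add0r.
have fibE x : p @^-1` [set x] `&` P = emb E (zmx R T *m col_mx x 0)
    (slice P' x).
  apply/seteqP; split=> [z [/= pz Pz]|_ [y Sy <-]]; last first.
    by rewrite -TE; split=> //=; rewrite pE.
  exists (dsubmx (zmx R (invmx T) *m z)).
    rewrite /slice /P' /= -pz [z in p z]zT -[X in p (_ *m X)]vsubmxK pE vsubmxK
      -zT //.
  rewrite -TE -pz [z in p z]zT -[X in p (_ *m X)]vsubmxK pE vsubmxK -zT //.
have iQE : i @` Q = emb E 0 Q.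
  apply/seteqP; split=> [_ [y Qy <-]|_ [y Qy <-]]; exists y => //.
    by rewrite iE TE col_mx0 mulmx0.
  by rewrite iE TE col_mx0 mulmx0.
have nsl x : B x -> slice P' x !=set0 by case/projB => y Py; exists y.
have conesP x : B x -> vertex_cones (slice P' x) = vertex_cones Q.
  move=> Bx; apply/normally_isomorphicP => //; first exact: slice_polytope.
    exact: nsl.
  by apply/(normally_isomorphic_emb LE (zmx R T *m col_mx x 0) 0);
    rewrite -fibE -iQE; apply: fib.
have overB : forall w, vertex P' w -> vertex B (usubmx w).
  apply: (vertices_over_base (Q := Q)) => //.
  have [g [gv ginj]] := comb_equiv_prod_vertices pB pQ cmb.
  exists (fun w => g (zmx R T *m w));
    split=> [w /(pullback_vertex P uT) /gv //|].
  move=> w w' /(pullback_vertex P uT) vw /(pullback_vertex P uT) vw'.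
  by move=> /(ginj _ _ vw vw') /(congr1 (mulmx (zmx R (invmx T))));
    rewrite !mulmxA zmxVK // !mul1mx.
have supp := affine_support pP' pB nP' cornP cornQ projB conesP overB.
have B0 : B 0.
  have -> : 0 = (1 - 2^-1) *: v + 2^-1 *: - v :> 'cV[R]_k.
    by apply/colP => j; rewrite !mxE; field.
  by apply: (polytope_convex pB) => //; lra.
have [m [A [c [[QE irr _] neatA]]]] := neatQ.
have [lam /choice [kap hA]] := choice (fun j => supp (row j A)^T).
pose h (x : 'cV[R]_k) : 'cV[R]_m :=
  \col_j ((kap j)%:~R + dot (zmx R (lam j)) x).
have rowE j (y : 'cV[R]_n) : (zmx R A *m y) j 0 = dot (zmx R (row j A)^T) y.
  by rewrite dot_row zmx_row zmx_tr.
have slE x : B x -> slice P' x = polyhedron (zmx R A) (h x).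
  move=> Bx; apply: (polyhedron_of_cones (c := zmx R c)).
  - exact: slice_polytope.
  - exact: nsl.
  - by rewrite -QE conesP.
  - by move=> y j Sy; rewrite rowE mxE; apply: (hA j).1.
  by move=> j; have [y Py e] := (hA j).2 x Bx; exists y => //; rewrite rowE mxE.
have sl0 : slice P' 0 = Q.
  have : emb E 0 Q = emb E 0 (slice P' 0).
    by rewrite -iQE zer // fibE col_mx0 mulmx0.
  by move=> /seteqP [/(emb_subset LE) s1 /(emb_subset LE) s2]; apply/seteqP.
(* the fibre over 0 is Q, on which row j reaches its bound *)
have kapE j : kap j = c j 0.
  apply: (@intr_inj R); apply/eqP; rewrite eq_le; apply/andP; split.
    have [y Py] := (hA j).2 0 B0; rewrite dot0r addr0 => <-; rewrite -rowE.
    have : Q y by rewrite -sl0.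
    by rewrite QE => /(_ j); rewrite [zmx R c j 0]mxE.
  have nQ' := nQ; rewrite QE in nQ'.
  have [y Py yj] := irredundant_tight j irr nQ'.
  have : Q y by rewrite QE.
  by rewrite -sl0 => /(hA j).1; rewrite -rowE yj dot0r addr0 mxE.
pose b : 'cV[int]_m := \col_j ((lam j)^T *m vz) 0 0.
have bE j : (b j 0)%:~R = dot (zmx R (lam j)) v by rewrite mxE vE dot_zmx.
have hv : h v = zmx R (c + b).
  by apply/colP => j; rewrite !mxE -!bE kapE rmorphD !mxE.
have hNv : h (- v) = zmx R (c + - b).
  by apply/colP => j; rewrite [LHS]mxE dotNr -bE kapE !mxE rmorphD rmorphN.
have ni x : B x -> normally_isomorphic (slice P' x) Q.
  move=> Bx; apply/normally_isomorphicP => //; first exact: slice_polytope.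
    exact: nsl.
  exact: conesP.
have [||y [Py PNy ly]] := neatA b.
- by rewrite -hv -slE //; apply: ni.
- by rewrite -hNv -slE //; apply: ni.
rewrite -hv -slE // in Py; rewrite -hNv -slE // in PNy.
exists (zmx R T *m col_mx v y); last exact: pE.
split=> //.
  apply: lattice_mul; case: ly => yz ->; exists (col_mx vz yz).
  by rewrite zmx_col_mx vE.
by rewrite -mulmxN opp_col_mx.
Qed.

End Lifting.

(** * Facet descriptions of lattice smooth polytopes *)

Section Facets.
Variables (R : realType) (n : nat).
Implicit Types (P Q : set 'cV[R]_n) (M : 'M[int]_n).

(** The sum of all generators but one points into the relative interior of the
    facet j.  The factor 2 leaves room on both sides of the point used below. *)
Lemma corner_relint m (A : 'M[R]_(m, n)) c v M j :
    corner (polyhedron A c) v M ->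
  exists2 d : R, 0 < d &
    polyhedron A c (v + (2 * d) *: \sum_(l | l != j) zmx R (col l M)).
Proof.
move=> cM; have Pv := corner_in cM.
have [i ai|d d0 Pd] := @polyhedron_step _ _ _ A c v
    (\sum_(l | l != j) zmx R (col l M)) Pv.
  rewrite dot_row dot_sumr sumr_le0 // => l _.
  apply: ((corner_cone _ cM).1 _ l); rewrite normal_cone1 // => y Py.
  by rewrite -!dot_row ai.
by exists (d / 2); rewrite ?divr_gt0 // mulrC divfK ?pnatr_eq0.
Qed.

(** A valid inequality that is tight at an inner point of facet j is tight on
    the whole facet, hence a multiple of the facet normal, and both are
    primitive. *)
Lemma facet_functional P v M j (r : 'cV[int]_n) (d h : R) :
    corner P v M -> 0 < d -> P
      (v + (2 * d) *: \sum_(l | l != j) zmx R (col l M)) ->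
    primitive r -> (forall x, P x -> dot (zmx R r) x <= h) ->
    dot (zmx R r) (v + d *: \sum_(l | l != j) zmx R (col l M)) = h ->
  r = - coordf M j /\ dot (zmx R r) v = h.
Proof.
move=> cM d0 P2 pr rle; set s := \sum_(l | _) _ in P2 *; move=> rd.
have Pv := corner_in cM; have uM := corner_unit cM.
have h1 := rle _ Pv; have h2 := rle _ P2.
move: rd h2; rewrite !dotDr !dotZr => rd h2.
have rv : dot (zmx R r) v = h by nra.
have rs : dot (zmx R r) s = 0 by nra.
have rM l : dot (zmx R r) (zmx R (col l M)) <= 0.
  apply: ((corner_cone _ cM).1 _ l); rewrite normal_cone1 // => y Py.
  by rewrite rv; apply: rle.
have rM0 l : l != j -> dot (zmx R r) (zmx R (col l M)) = 0.
  move=> lj; apply: (@sum_tight _ _ (fun l => l != j)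
    (fun l => dot (zmx R r) (zmx R (col l M))) (fun=> 0)) => // .
  by rewrite big1 // -dot_sumr rs.
split=> //.
pose z := (r^T *m col j M) 0 0.
have zE : dot (zmx R r) (zmx R (col j M)) = z%:~R by rewrite dot_zmx.
apply: (primitive_scale pr (s := - z)); last first.
  by rewrite oppr_ge0 -(ler_int R) -zE rM.
apply: (@zmx_inj R); apply/eqP; rewrite -subr_eq0; apply/eqP/colP => i.
rewrite [RHS]mxE -dot_delta dotC -[delta_mx i 0]mul1mx -(zmxK R uM) -mulmxA.
rewrite dot_mul_cols big1 // => l _.
rewrite scalerN scaleNr opprK zmxZ dotDl dotNl dotZl dot_coordf_col //.
have [<-|jl] := eqVneq j l; first by rewrite zE mulr1 subrr mul0r.
by rewrite mulr0 rM0 ?subrr ?mul0r // eq_sym.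
Qed.

(** From an inner point of facet j one could step further out if no row were
    tight there. *)
Lemma corner_tight_row m (A : 'M[int]_(m, n)) (c : 'cV[R]_m) v M j :
    (forall i, primitive (row i A)^T) -> corner (polyhedron (zmx R A) c) v M ->
  exists i, (row i A)^T = - coordf M j /\ (zmx R A *m v) i 0 = c i 0.
Proof.
move=> prA cM; have Pv := corner_in cM; have uM := corner_unit cM.
have [d d0 P2] := corner_relint j cM; set P := polyhedron _ _ in cM P2 Pv.
set s := \sum_(l | _) _ in P2.
have Pq : P (v + d *: s).
  have -> : v + d *: s = (1 - 2^-1) *: v + 2^-1 *: (v + (2 * d) *: s).
    by apply/colP => k; rewrite !mxE; field.
  by apply: polyhedron_convex => //; lra.
have rowE i x : (zmx R A *m x) i 0 = dot (zmx R (row i A)^T) x.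
  by rewrite dot_row zmx_row zmx_tr.
have [[i qi]|nq] := pselect (exists i, (zmx R A *m (v + d *: s)) i 0 = c i 0).
  exists i; rewrite rowE; rewrite rowE in qi.
  by apply: (facet_functional cM d0 P2) => // x /(_ i); rewrite rowE.
have [i qi|t t0 Pt] := @polyhedron_step _ _ _ (zmx R A) c _ (- zmx R (col j M))
    Pq.
  by case: nq; exists i.
have := corner_coordf j cM Pt;
  rewrite !dotDr !dotZr dotNr dot_coordf_col // eqxx.
rewrite [dot _ s](_ : _ = 0) /=; first by move=> ?; exfalso; lra.
rewrite dot_sumr big1 // => l lj;
  rewrite dot_coordf_col // eq_sym (negPf lj) //.
Qed.

(** Of two inequalities with the same row, one implies the other. *)
Lemma irredundant_row_inj m (A : 'M[int]_(m, n)) (c : 'cV[R]_m) i j :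
  irredundant (zmx R A) c -> row i A = row j A -> i = j.
Proof.
move=> irr e; apply/eqP/negPn/negP => ij.
have rowE (x : 'cV[R]_n) : (zmx R A *m x) i 0 = (zmx R A *m x) j 0.
  by rewrite !dot_row !zmx_row e.
have [x [hx xi]] := irr i; have [y [hy yj]] := irr j.
have := hx j; have := hy i ij; rewrite eq_sym => h1 /(_ ij) h2.
by move: xi yj h1 h2; rewrite !rowE; lra.
Qed.

(** The rows are the outer facet normals at the corners of Q, listed without
    repetition; the right-hand sides are integral since the vertices are.  A
    point just outside an inner point of a facet violates only its
    inequality. *)
Lemma exists_facet_description Q : lattice_smooth Q ->
  exists m (A : 'M[int]_(m, n)) c, facet_description Q A c.
Proof.
move=> /lattice_smoothP [pQ nQ cornQ].
have [V hV] := finite_vertices pQ.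
have pick v : exists M, vertex Q v -> corner Q v M.
  have [/cornQ [_ [M cM]]|nv] := pselect (vertex Q v); first by exists M.
  by exists 0.
have [Mf hM] := choice pick.
pose rs := undup [seq - row j (invmx (Mf v)) | v <- V, j <- enum 'I_n].
pose A : 'M[int]_(size rs, n) := \matrix_i nth 0 rs i.
have rowP i : exists ci : int, exists v j, [/\ vertex Q v,
    (row i A)^T = - coordf (Mf v) j & dot (zmx R (row i A)^T) v = ci%:~R].
  have : nth 0 rs i \in rs by apply: mem_nth.
  rewrite mem_undup => /allpairsP [[v j] /= [/hV vv _ e]].
  have [lv _] := cornQ v vv; have [z zE] := dot_lattice (row i A)^T lv.
  exists z, v, j; split=> //.
  by rewrite rowK e linearN.
have [cf hc] := choice rowP; pose c := \col_i cf i.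
have rowE i x : (zmx R A *m x) i 0 = dot (zmx R (row i A)^T) x.
  by rewrite dot_row zmx_row zmx_tr.
have cE i : zmx R c i 0 = (cf i)%:~R by rewrite !mxE.
have row_of v j : vertex Q v -> exists i, (row i A)^T = - coordf (Mf v) j.
  move=> vv; have : - row j (invmx (Mf v)) \in rs.
    rewrite mem_undup; apply/allpairsP; exists (v, j).
    by rewrite mem_enum; split=> //=; apply/hV.
  move=> /(nthP 0) [i ir e]; exists (Ordinal ir).
  by rewrite rowK /= e linearN.
have max_at v j i x : vertex Q v -> (row i A)^T = - coordf (Mf v) j -> Q x ->
    dot (zmx R (row i A)^T) x <= dot (zmx R (row i A)^T) v.
  move=> vv -> Qx; rewrite zmxN !dotNl lerN2.
  exact: corner_coordf (hM v vv) Qx.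
have Qle i x : Q x -> dot (zmx R (row i A)^T) x <= (cf i)%:~R.
  by move=> Qx; have [v [j [vv e <-]]] := hc i; apply: max_at e Qx.
have QE : Q = polyhedron (zmx R A) (zmx R c).
  apply/seteqP; split=> [x Qx i|y Ay]; first by rewrite rowE cE; apply: Qle.
  have [[m0 [A0 [c0 eQ]]] _] := pQ; rewrite eQ => i.
  have [v vv [Qv vmax]] := polytope_max (row i A0)^T pQ nQ.
  have cM := hM v vv; have uM := corner_unit cM.
  pose a := zmx R (invmx (Mf v)) *m (y - v).
  have ya : y = v + zmx R (Mf v) *m a.
    by rewrite /a mulmxA zmxK // mul1mx addrC subrK.
  have a0 l : 0 <= a l 0.
    have [i' e] := row_of v l vv; have := Ay i'; rewrite rowE cE.
    have [v' [j' [vv' e' <-]]] := hc i'.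
    have := max_at _ _ _ _ vv' e' Qv;
      have := max_at _ _ _ _ vv e (vertex_in vv').
    rewrite ya dotDr e zmxN !(dotNl (zmx R _ *m _)) dot_coordf //; lra.
  rewrite dot_row ya dotDr; apply: le_trans (_ : dot (row i A0)^T v <= _);
    last first.
    by rewrite -dot_row; move: Qv; rewrite eQ; apply.
  rewrite gerDl dot_mul_cols sumr_le0 // => l _; rewrite mulr_le0_ge0 //.
  by apply: ((corner_cone _ cM).1 _ l); rewrite normal_cone1.
exists (size rs), A, c; split=> //; last first.
  move=> i; have [v [j [vv -> _]]] := hc i.
  have := primitive_coordf j (corner_unit (hM v vv)).
  move=> /primitiveP pr; apply/primitiveP => z w e; apply: (pr z (- w)).
  by rewrite scalerN -e opprK.
move=> i; have [v [j [vv ei ci]]] := hc i.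
have cM := hM v vv; have uM := corner_unit cM.
have cM' := cM; rewrite QE in cM'; have [d d0 P2] := corner_relint j cM'.
rewrite -QE in P2; set s := \sum_(l | _) _ in P2.
have tight i' : i' != i -> (zmx R A *m (v + d *: s)) i' 0 < zmx R c i' 0.
  move=> ii; rewrite rowE cE lt_neqAle; apply/andP; split; last first.
    apply: Qle; have -> : v + d *: s = (1 - 2^-1) *: v + 2^-1 *:
      (v + (2 * d) *: s).
      by apply/colP => k; rewrite !mxE; field.
    by apply: polytope_convex => //; [exact: vertex_in|lra].
  apply: contra_neq ii => tq.
  have pr : primitive (row i' A)^T.
    have [v' [j' [vv' -> _]]] := hc i'.
    have := primitive_coordf j' (corner_unit (hM v' vv')).
    move=> /primitiveP pr; apply/primitiveP => z w e; apply: (pr z (- w)).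
    by rewrite scalerN -e opprK.
  have [e _] := facet_functional cM d0 P2 pr (Qle i') tq.
  have : nth 0 rs i' = nth 0 rs i.
    by apply: trmx_inj; rewrite -!(rowK (fun i => nth 0 rs (nat_of_ord i))) e
      ei.
  by move/eqP; rewrite nth_uniq ?undup_uniq // => /eqP /val_inj.
have [||t t0 ht] := @small_step R 'I_(size rs)
  (fun i' => if i' == i then 1 else zmx R c i' 0 - (zmx R A *m (v + d *: s)) i'
    0)
  (fun i' => if i' == i then 0 else - (zmx R A *m zmx R (col j (Mf v))) i' 0).
- by move=> i'; case: eqVneq => // /tight; rewrite subr_ge0 => /ltW.
- by move=> i'; case: eqVneq => // /tight h e; move: h;
    rewrite -subr_gt0 e ltxx.
(* a point just outside facet j *)
exists (v + d *: s - t *: zmx R (col j (Mf v))); split=> [i' ii|].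
  have := ht i'; rewrite (negPf ii) mulmxBE mulmxZE; lra.
rewrite rowE cE -ci ei zmxN !dotNl ltrN2 !dotBr dotDr !dotZr dot_coordf_col //
  eqxx.
rewrite (_ : dot _ s = 0) /=; first by lra.
by rewrite dot_sumr big1 // => l lj;
  rewrite dot_coordf_col // eq_sym (negPf lj).
Qed.

End Facets.

(** * Moving the facets *)

Section Moving.
Variables (R : realType) (n m : nat) (Q : set 'cV[R]_n).
Variables (A : 'M[int]_(m, n)) (c : 'cV[int]_m).
Hypothesis smQ : lattice_smooth Q.
Hypothesis fdQ : facet_description Q A c.

Let rowE i (x : 'cV[R]_n) : (zmx R A *m x) i 0 = dot (zmx R (row i A)^T) x.
Proof. by rewrite dot_row zmx_row zmx_tr. Qed.

Lemma facet_rows v M : vertex Q v -> corner Q v M ->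
  exists idx : 'I_n -> 'I_m, forall j, (row (idx j) A)^T = - coordf M j /\
    dot (zmx R (coordf M j)) v = - (c (idx j) 0)%:~R.
Proof.
move=> vv; have [QE irr pr] := fdQ; rewrite {1}QE => cM.
suff /choice [idx hidx] : forall j, exists i, (row i A)^T = - coordf M j /\
    dot (zmx R (coordf M j)) v = - (c i 0)%:~R by exists idx.
move=> j.
have [i [e vi]] := corner_tight_row j pr cM; exists i; split=> //.
by move: vi; rewrite rowE e zmxN dotNl mxE => <-; rewrite opprK.
Qed.

(** At a vertex maximizing u over Q, the functional u is a nonnegative
    combination of facet normals. *)
Lemma bounded_above c' u : exists K, forall y,
  polyhedron (zmx R A) c' y -> dot u y <= K.
Proof.
have [pQ nQ cornQ] := (lattice_smoothP Q).1 smQ.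
have [v vv uv] := polytope_max u pQ nQ; have [_ [M cM]] := cornQ v vv.
have uM := corner_unit cM; have [idx hidx] := facet_rows vv cM.
exists (dot u v - \sum_l dot u (zmx R (col l M)) *
  (c' (idx l) 0 + dot (zmx R (coordf M l)) v)) => y Py.
have {1}-> : y = v + zmx R M *m (zmx R (invmx M) *m (y - v)).
  by rewrite mulmxA zmxK // mul1mx addrC subrK.
rewrite dotDr lerD2l dot_mul_cols -sumrN; apply: ler_sum => l _.
have ul : dot u (zmx R (col l M)) <= 0.
  by apply: ((corner_cone _ cM).1 _ l); apply/face_normal_cone1.
rewrite -mulrN; apply: ler_wnM2l => //.
rewrite -(dot_coordf l _ uM) mulmxA zmxK // mul1mx dotBr.
have := Py (idx l); rewrite rowE (hidx l).1 zmxN dotNl; lra.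
Qed.

Lemma polyhedron_bounded c' : exists K : R, forall y,
  polyhedron (zmx R A) c' y -> forall i, `|y i 0| <= K.
Proof.
have [f hf] := choice (fun i => bounded_above c' (delta_mx i 0)).
have [g hg] := choice (fun i => bounded_above c' (- delta_mx i 0)).
exists (\sum_i (`|f i| + `|g i|)) => y Py i.
rewrite (bigD1 i) //= ler_wpDr ?sumr_ge0 // => [j _|];
  first by rewrite addr_ge0.
have := hf i y Py; have := hg i y Py; rewrite dotNl dot_delta.
have := ler_norm (f i); have := ler_norm (g i).
have := normr_ge0 (f i); have := normr_ge0 (g i).
by rewrite ler_norml => *; apply/andP; split; lra.
Qed.

Lemma polyhedron_polytope c' : polytope (polyhedron (zmx R A) c').
Proof.
by split; [exists m, (zmx R A), c'|exact: polyhedron_bounded].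
Qed.

(** The facet normals at v are tight in the displaced polytope too
    ([corner_tight_row]), and these n equations determine the vertex: it moves
    by an integral vector that is linear in b. *)
Lemma displaced_corner b v M idx : vertex Q v -> corner Q v M ->
    (forall j, (row (idx j) A)^T = - coordf M j /\
      dot (zmx R (coordf M j)) v = - (c (idx j) 0)%:~R) ->
    normally_isomorphic (polyhedron (zmx R A) (zmx R (c + b))) Q ->
  corner (polyhedron (zmx R A) (zmx R (c + b)))
    (v - zmx R (M *m (\col_j b (idx j) 0))) M.
Proof.
move=> vv cM hidx ni; have uM := corner_unit cM.
have [pQ nQ cornQ] := (lattice_smoothP Q).1 smQ; have [QE irr pr] := fdQ.
set S := polyhedron _ _ in ni *.
have pS : polytope S by apply: polyhedron_polytope.
have nS : S !=set0.
  have : normal_fan Q (normal_cone Q [set v]).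
    by exists [set v]; split=> //; exists v.
  rewrite -ni => -[F [[->[]//|[u ->]] [x [Sx _]] _]]; by exists x.
move/(normally_isomorphicP pS pQ nS nQ) : ni => cones.
have : vertex_cones Q (normal_cone Q [set v]) by exists v.
rewrite -cones => -[w vw ew].
have cw : corner S w M.
  apply: corner_polyhedron => //; first exact: vertex_in.
  by move=> u; rewrite ew; apply: corner_cone.
suff -> : v - zmx R (M *m (\col_j b (idx j) 0)) = w by [].
have wE j : dot (zmx R (coordf M j)) w = - ((c + b) (idx j) 0)%:~R.
  have [i [ei wi]] := corner_tight_row j pr cw.
  have -> : idx j = i.
    apply: (irredundant_row_inj irr); apply: trmx_inj.
    by rewrite ei (hidx j).1.
  by move: wi; rewrite rowE ei zmxN dotNl [zmx R _ i 0]mxE => <-; rewrite opprK.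
have vE : v = w + zmx R (M *m (\col_j b (idx j) 0)).
  rewrite -[LHS]mul1mx -[RHS]mul1mx -(zmxK R uM) -!mulmxA; congr (_ *m _).
  apply/colP => j; have E z :
    (zmx R (invmx M) *m z) j 0 = dot (zmx R (coordf M j)) z.
    by rewrite dot_row zmx_row zmx_tr.
  rewrite !E dotDr wE (hidx j).2 zmxM dot_coordf // !mxE rmorphD /=; ring.
by rewrite {1}vE addrK.
Qed.

(** The displacements for b and - b are opposite, and the corner at height t is
    a convex combination of those at heights 1 and -1. *)
Lemma moving_corner b v M : vertex Q v -> corner Q v M ->
    normally_isomorphic (polyhedron (zmx R A) (zmx R (c + b))) Q ->
    normally_isomorphic (polyhedron (zmx R A) (zmx R (c - b))) Q ->
  exists e : 'cV[int]_n, forall t, -1 <= t <= 1 ->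
    corner (polyhedron (zmx R A) (zmx R c + t *: zmx R b)) (v + t *: zmx R e) M.
Proof.
move=> vv cM nib niN; have [idx hidx] := facet_rows vv cM.
have uM := corner_unit cM.
pose e : 'cV[int]_n := - (M *m (\col_j b (idx j) 0)); exists e => t t01.
have cP : corner (polyhedron (zmx R A) (zmx R c + zmx R b)) (v + zmx R e) M.
  by rewrite -zmxD zmxN; apply: displaced_corner.
have cN : corner (polyhedron (zmx R A) (zmx R c - zmx R b)) (v - zmx R e) M.
  have := displaced_corner vv cM hidx niN.
  rewrite zmxD zmxN (_ : \col_j (- b) (idx j) 0 = - \col_j b (idx j) 0).
    by rewrite mulmxN.
  by apply/colP => j; rewrite !mxE.
have mix x y : polyhedron (zmx R A) (zmx R c + zmx R b) x ->
    polyhedron (zmx R A) (zmx R c - zmx R b) y ->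
    polyhedron (zmx R A) (zmx R c + t *: zmx R b)
      (((1 + t) / 2) *: x + ((1 - t) / 2) *: y).
  move=> Px Py i; have := Px i; have := Py i.
  rewrite mulmxDE !mulmxZE.
  have -> : (zmx R c + zmx R b) i 0 = (c i 0)%:~R + (b i 0)%:~R by rewrite !mxE.
  have -> : (zmx R c - zmx R b) i 0 = (c i 0)%:~R - (b i 0)%:~R by rewrite !mxE.
  have -> : (zmx R c + t *: zmx R b) i 0 = (c i 0)%:~R + t * (b i 0)%:~R.
    by rewrite !mxE.
  by move: t01 => /andP [? ?] ? ?; nra.
split=> //.
- have := mix _ _ (corner_in cP) (corner_in cN); congr (polyhedron _ _ _).
  by apply/colP => i; rewrite !mxE; field.
- move=> x Px; exists (zmx R (invmx M) *m (x - (v + t *: zmx R e))).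
    move=> j; rewrite -(dot_coordf j _ uM) mulmxA zmxK // mul1mx dotBr dotDr
      dotZr.
    have := Px (idx j); rewrite rowE (hidx j).1 (hidx j).2 !zmxN dotNl dotNr
      zmxM.
    by rewrite dot_coordf // !mxE; lra.
  by rewrite mulmxA zmxK // mul1mx addrC subrK.
move=> j; have [s s0 Ps] := corner_edge cP j;
  have [r r0 Pr] := corner_edge cN j.
exists ((1 + t) / 2 * s + (1 - t) / 2 * r); first by move: t01 => /andP [? ?];
  nra.
have := mix _ _ Ps Pr; congr (polyhedron _ _ _).
by apply/colP => i; rewrite !mxE; field.
Qed.

End Moving.

(** * The prism over a pair of opposite displacements *)

Section Prism.
Variables (R : realType) (n m : nat) (Q : set 'cV[R]_n).
Variables (A : 'M[int]_(m, n)) (c : 'cV[int]_m).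
Hypothesis smQ : lattice_smooth Q.
Hypothesis fdQ : facet_description Q A c.

Let pQ : polytope Q. Proof. by case: ((lattice_smoothP Q).1 smQ). Qed.
Let nQ : Q !=set0. Proof. by case: ((lattice_smoothP Q).1 smQ). Qed.

Definition layer (b : 'cV[int]_m) (t : R) : set 'cV[R]_n :=
  polyhedron (zmx R A) (zmx R c + t *: zmx R b).

Definition prism (b : 'cV[int]_m) : set 'cV[R]_(1 + n) :=
  [set z | segment11 R (usubmx z) /\ layer b (usubmx z 0 0) (dsubmx z)].

Lemma layerP b t y : layer b t y <->
  forall j, (zmx R A *m y) j 0 <= (c j 0)%:~R + t * (b j 0)%:~R.
Proof.
have E j : (zmx R c + t *: zmx R b) j 0 = (c j 0)%:~R + t * (b j 0)%:~R.
  by rewrite !mxE.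
by rewrite /layer; split=> h j; have := h j; rewrite E.
Qed.

Lemma layer0 b : layer b 0 = Q.
Proof. by rewrite /layer scale0r addr0; case: fdQ. Qed.

Lemma prism_slice b x : segment11 R x -> slice (prism b) x = layer b (x 0 0).
Proof.
move=> sx; apply/seteqP; split=> y;
  rewrite /slice /prism /= col_mxKu col_mxKd //.
by case.
Qed.

Lemma prism_polytope b : polytope (prism b).
Proof.
split.
  pose C : 'M[R]_((1 + 1) + m, 1 + n) :=
    col_mx (col_mx (row_mx 1%:M 0) (row_mx (- 1%:M) 0))
      (row_mx (- zmx R b) (zmx R A)).
  pose d : 'cV[R]_((1 + 1) + m) :=
    col_mx (col_mx (const_mx 1) (const_mx 1)) (zmx R c).
  have CE z : C *m z = col_mx (col_mx (usubmx z) (- usubmx z))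
      (- (zmx R b *m usubmx z) + zmx R A *m dsubmx z).
    rewrite -{1}[z]vsubmxK !mul_col_mx !mul_row_col !mul0mx !addr0 mul1mx.
    by rewrite !mulNmx mul1mx.
  have low (z : 'cV[R]_(1 + n)) j :
      (- (zmx R b *m usubmx z) + zmx R A *m dsubmx z) j 0 =
      (zmx R A *m dsubmx z) j 0 - usubmx z 0 0 * (b j 0)%:~R.
    have add (p q : 'cV[R]_m) : (- p + q) j 0 = q j 0 - p j 0.
      by rewrite !mxE addrC.
    rewrite add; congr (_ - _); rewrite mxE big_ord1 mulrC.
    by congr (_ * _); rewrite mxE.
  have cE j : zmx R c j 0 = (c j 0)%:~R by rewrite mxE.
  exists ((1 + 1) + m)%N, C, d; apply/seteqP; split=> z.
    move=> [/andP [z1 z2] /layerP hz] i; rewrite CE /d.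
    case: (split_ordP i) => j ->; first case: (split_ordP j) => l ->.
    - by rewrite !col_mxEu !ord1 [X in _ <= X]mxE.
    - by rewrite !col_mxEu !col_mxEd !ord1 mxE [X in _ <= X]mxE; lra.
    by rewrite !col_mxEd low cE; have := hz j; lra.
  move=> h; have h1 := h (lshift _ (lshift _ ord0)).
  have h2 := h (lshift _ (rshift _ ord0)).
  have h3 j := h (rshift _ j).
  have neg (p : 'cV[R]_1) : (- p) ord0 0 = - p 0 0 by rewrite !mxE.
  rewrite CE /d !col_mxEu [X in _ <= X]mxE in h1.
  rewrite CE /d !col_mxEu !col_mxEd neg [X in _ <= X]mxE in h2.
  split; first by apply/andP; split; lra.
  by apply/layerP => j; have := h3 j; rewrite CE /d !col_mxEd low cE; lra.
have [K hK] := polyhedron_bounded smQ fdQ (zmx R c + \col_j `|zmx R b j 0|).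
exists (1 + `|K|) => z [/andP [z1 z2] hz] i.
have K0 := normr_ge0 K.
rewrite -[z]vsubmxK; case: (split_ordP i) => j ->.
  by rewrite col_mxEu ord1 ler_norml; apply/andP; split; lra.
rewrite col_mxEd; apply: le_trans (_ : K <= _); last by have := ler_norm K; lra.
apply: hK => l; have := (layerP _ _ _).1 hz l;
  move: (usubmx z 0 0) z1 z2 => t t1 t2.
have -> : (zmx R c + \col_j0 `|zmx R b j0 0|) l 0 = (c l 0)%:~R +
    `|(b l 0)%:~R|.
  by rewrite !mxE.
move/le_trans; apply; rewrite lerD2l; apply: le_trans (ler_norm _) _.
by rewrite normrM ler_piMl // ler_norml t1.
Qed.

(** The vertex v moves with velocity e v as the height t varies, and the columns
    of Mf v are its edge directions at all heights. *)
Variables (b : 'cV[int]_m) (Mf : 'cV[R]_n -> 'M[int]_n)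
  (e : 'cV[R]_n -> 'cV[int]_n).
Hypothesis moving : forall v, vertex Q v -> forall t, -1 <= t <= 1 ->
  corner (layer b t) (v + t *: zmx R (e v)) (Mf v).

Let corner0 v : vertex Q v -> corner Q v (Mf v).
Proof.
move=> vv; have := moving vv (t := 0); rewrite layer0 scale0r addr0; apply.
by apply/andP; split; lra.
Qed.

Lemma moving_cone v t u : vertex Q v -> -1 <= t <= 1 ->
  normal_cone (layer b t) [set v + t *: zmx R (e v)] u <->
    normal_cone Q [set v] u.
Proof.
by move=> vv t1; rewrite (corner_cone _ (moving vv t1))
  (corner_cone _ (corner0 vv)).
Qed.

Lemma layer_max v t u y : vertex Q v -> normal_cone Q [set v] u ->
    -1 <= t <= 1 ->
  layer b t y -> dot u y <= dot u v + t * dot u (zmx R (e v)).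
Proof.
move=> vv uv t1 Py; rewrite -dotZr -dotDr.
have := (moving_cone u vv t1).2 uv; rewrite normal_cone1; first exact.
exact: corner_in (moving vv t1).
Qed.

(** A functional is maximal on a layer at the moved copy of the vertex where it
    is maximal on Q. *)
Lemma layer_vertex_cones t : -1 <= t <= 1 ->
  vertex_cones (layer b t) = vertex_cones Q.
Proof.
move=> t1; have cone v : vertex Q v ->
    normal_cone (layer b t) [set v + t *: zmx R (e v)] = normal_cone Q [set v].
  by move=> vv; apply/seteqP; split=> u /(moving_cone u vv t1).
apply/seteqP; split=> [_ [z vz <-]|_ [v vv <-]]; last first.
  exists (v + t *: zmx R (e v)); last exact: cone.
  exact: corner_vertex (moving vv t1).
have [u eu] := (vertexP _ _).1 vz.
have [v vv uv] := polytope_max u pQ nQ; exists v; rewrite // -cone //.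
have : face (layer b t) u (v + t *: zmx R (e v)).
  by apply/face_normal_cone1/moving_cone => //; apply/face_normal_cone1.
by rewrite eu => ->.
Qed.

Definition moving_point (i : R * 'cV[R]_n) : 'cV[R]_(1 + n) :=
  col_mx (const_mx i.1) (i.2 + i.1 *: zmx R (e i.2)).

Definition signed_vertex : set (R * 'cV[R]_n) :=
  [set i | (i.1 = 1 \/ i.1 = -1) /\ vertex Q i.2].

Lemma prism_in v t : vertex Q v -> -1 <= t <= 1 ->
    prism b (moving_point (t, v)).
Proof.
move=> vv t1; rewrite /prism /moving_point /= col_mxKu col_mxKd /segment11 /=
  mxE.
by split=> //; apply: corner_in (moving vv t1).
Qed.

Lemma sign_in (s : R) : s = 1 \/ s = -1 -> -1 <= s <= 1.
Proof. by case=> ->; apply/andP; split; lra. Qed.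

Lemma dot1 (x y : 'cV[R]_1) : dot x y = x 0 0 * y 0 0.
Proof. by rewrite /dot big_ord1. Qed.

Lemma dot_moving_point g t v : dot g (moving_point (t, v)) =
  dot (dsubmx g) v + t * (usubmx g 0 0 + dot (dsubmx g) (zmx R (e v))).
Proof.
rewrite dot_split col_mxKu col_mxKd dot1 dotDr dotZr [const_mx _ _ _]mxE /=.
by ring.
Qed.

(** On each layer the maximum of g is reached at the moving vertex, and the
    value there is affine in the height, with the slope in the last line. *)
Lemma face_prism g i : signed_vertex i -> face (prism b) g (moving_point i) <->
  normal_cone Q [set i.2] (dsubmx g) /\
  0 <= i.1 * (usubmx g 0 0 + dot (dsubmx g) (zmx R (e i.2))).
Proof.
case: i => s v [/= hs vv]; have s1 := sign_in hs.
split=> [[_ h]|[uv h]].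
  split.
    apply/(moving_cone _ vv s1); rewrite normal_cone1;
      last exact: corner_in (moving vv s1).
    move=> y Ly; have := h (col_mx (const_mx s) y).
    rewrite !dot_split !col_mxKu !col_mxKd lerD2l; apply.
    by rewrite /prism /= col_mxKu col_mxKd /segment11 /= mxE.
  have s1' : -1 <= - s <= 1 by move: s1 => /andP [? ?]; apply/andP; split; lra.
  by have := h _ (prism_in vv s1'); rewrite !dot_moving_point; lra.
split; first exact: prism_in.
move=> z [z1 hz]; have := layer_max vv uv z1 hz; rewrite dot_moving_point.
rewrite dot_split dot1 => le1.
move: z1 => /andP [z1 z2]; case: hs h => ->; nra.
Qed.

Lemma prism_vertex w : vertex (prism b) w ->
    exists2 i, signed_vertex i & w = moving_point i.
Proof.
move=> /vertexP [g eg].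
have [v vv uv] := polytope_max (dsubmx g) pQ nQ.
pose a := usubmx g 0 0 + dot (dsubmx g) (zmx R (e v)).
have [s hs sa] : exists2 s : R, s = 1 \/ s = -1 & 0 <= s * a.
  by have [a0|a0] := lerP 0 a; [exists 1|exists (-1)]; try (by [left|right]);
    lra.
have ix : signed_vertex (s, v) by [].
exists (s, v) => //.
have : face (prism b) g (moving_point (s, v)).
  by apply/face_prism => //; split=> //; apply/face_normal_cone1.
by rewrite eg => ->.
Qed.

(** The generators at a vertex are those of the layer, together with the
    vertical edge (- s, - s e_v), which leads towards the opposite layer. *)
Lemma prism_corner i : signed_vertex i ->
    exists N, corner (prism b) (moving_point i) N.
Proof.
case: i => s v [/= hs vv]; have s1 := sign_in hs; have cs := moving vv s1.
have uM := corner_unit cs.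
have [z hz] : exists z : int, s = z%:~R /\ (z = 1 \/ z = -1).
  by case: hs => ->; [exists 1|exists (-1)]; split;
    rewrite ?rmorphN ?rmorph1 //; [left|right].
have ss : s * s = 1 by case: hs => ->; ring.
pose N : 'M[int]_(1 + n) := block_mx (const_mx (- z)) 0 (- z *: e v) (Mf v).
have NE a y : zmx R N *m col_mx (const_mx a) y =
    col_mx (const_mx (- s * a)) (- (s * a) *: zmx R (e v) + zmx R (Mf v) *m y).
  have -> : zmx R N = block_mx (const_mx (- s)) 0 (- s *: zmx R (e v))
      (zmx R (Mf v)).
    rewrite /zmx map_block_mx map_mx0 map_mxZ !rmorphN /= -hz.1; congr block_mx.
    by apply/matrixP => i j; rewrite !mxE rmorphN /= hz.1.
  rewrite mul_block_col mul0mx addr0; congr col_mx.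
    by apply/colP => i; rewrite !mxE big_ord1 !mxE.
  congr (_ + _); apply/colP => i; rewrite !mxE big_ord1 !mxE; ring.
have colN j : zmx R (col j N) = zmx R N *m delta_mx j 0 by rewrite -zmx_col
    colE.
exists N; split.
- exact: prism_in.
- rewrite unitmxE det_lblock unitrM -!unitmxE uM andbT unitmxE det_mx11 mxE.
  by case: hz.2 => ->.
- move=> w [w1 hw]; pose t := usubmx w 0 0.
  have [a a0 ea] := corner_sub (moving vv w1) hw; rewrite -/t in ea.
  exists (col_mx (const_mx (1 - s * t)) a).
    move=> j; case: (split_ordP j) => l ->; last by rewrite col_mxEd.
    rewrite col_mxEu mxE; move: w1 => /andP []; rewrite -/t => *.
    by case: hs => ->; lra.
  rewrite NE /moving_point add_col_mx -[w]vsubmxK; congr col_mx.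
    apply/colP => l; rewrite !mxE !ord1 -/t.
    have -> : s + - s * (1 - s * t) = s * s * t by ring.
    by rewrite ss mul1r /t mxE.
  rewrite ea /= addrA -addrA addrA; congr (_ + _).
  rewrite -addrA -scalerDl; congr (_ + _ *: _).
  have -> : s - s * (1 - s * t) = s * s * t by ring.
  by rewrite ss mul1r.
move=> j; rewrite colN; case: (split_ordP j) => l ->.
  exists 1 => //; rewrite scale1r.
  have -> : delta_mx (lshift n l) 0 = col_mx (const_mx 1) 0 :> 'cV[R]_(1 + n).
    apply/colP => i; case: (split_ordP i) => r ->.
      by rewrite col_mxEu !mxE !ord1 !eqxx.
    by rewrite col_mxEd !mxE eq_rlshift.
  rewrite NE mulmx0 addr0 /moving_point add_col_mx /=.
  have := prism_in vv (_ : -1 <= 0 <= 1); rewrite /moving_point /=.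
  move=> /(_ _) h; have {}h := h (introT andP (conj _ _)).
  have -> : col_mx (const_mx s + const_mx (- s * 1))
      (v + s *: zmx R (e v) + - (s * 1) *: zmx R (e v)) = col_mx (const_mx 0)
        (v + 0 *: zmx R (e v)) :> 'cV[R]_(1 + n).
    congr col_mx; first by apply/colP => i; rewrite !mxE; ring.
    by rewrite mulr1 scaleNr addrK scale0r addr0.
  by apply: h; lra.
have [r r0 Pr] := corner_edge cs l; exists r => //.
have -> : delta_mx (rshift 1 l) 0 = col_mx (const_mx 0) (delta_mx l 0) :>
    'cV[R]_(1 + n).
  apply/colP => i; case: (split_ordP i) => q ->.
    by rewrite col_mxEu !mxE eq_lrshift.
  by rewrite col_mxEd !mxE eq_rshift.
rewrite NE !mulr0 oppr0 scale0r add0r /moving_point scale_col_mx add_col_mx /=.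
rewrite /prism /= col_mxKu col_mxKd /segment11 /= !mxE mulr0 addr0; split=> //.
by move: Pr; rewrite -zmx_col colE.
Qed.

Lemma prism_lattice_smooth : lattice_smooth (prism b).
Proof.
apply/lattice_smoothP; split; first exact: prism_polytope.
  have [v vv _] := polytope_max 0 pQ nQ; exists (moving_point (0, v)).
  by apply: prism_in => //; apply/andP; split; lra.
move=> w /prism_vertex [i ix ->]; split; last exact: prism_corner.
case: i ix => s v [/= hs vv];
  have [_ _ /(_ v vv) [[z zv] _]] := (lattice_smoothP Q).1 smQ.
have [y ys] : exists y : int, s = y%:~R.
  by case: hs => ->; [exists 1|exists (-1)].
exists (col_mx (const_mx y) (z + y *: e v));
  rewrite /moving_point /= zmx_col_mx zmxD zmxZ.
by rewrite -ys -zv; congr col_mx; apply/colP => j; rewrite !mxE.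
Qed.

End Prism.

Arguments prism R {n m} A c b _.

Section PrismBundle.
Variables (R : realType) (n m : nat) (Q : set 'cV[R]_n).
Variables (A : 'M[int]_(m, n)) (c : 'cV[int]_m).
Hypothesis smQ : lattice_smooth Q.
Hypothesis fdQ : facet_description Q A c.

Let pQ : polytope Q. Proof. by case: ((lattice_smoothP Q).1 smQ). Qed.
Let nQ : Q !=set0. Proof. by case: ((lattice_smoothP Q).1 smQ). Qed.

Lemma layer_const t : layer A c 0 t = Q.
Proof. by rewrite /layer zmx0 scaler0 addr0; case: fdQ. Qed.

Lemma prism_const : prism R A c 0 = prod_set (segment11 R) Q.
Proof.
apply/seteqP; split=> [z [sz]|_ [x sx [y Qy <-]]].
  by rewrite layer_const => Qz; exists (usubmx z) => //; exists (dsubmx z);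
    rewrite ?vsubmxK.
by split; rewrite ?col_mxKu ?col_mxKd ?layer_const.
Qed.

Variables (b : 'cV[int]_m) (Mf : 'cV[R]_n -> 'M[int]_n)
  (e : 'cV[R]_n -> 'cV[int]_n).
Hypothesis moving : forall v, vertex Q v -> forall t, -1 <= t <= 1 ->
  corner (layer A c b t) (v + t *: zmx R (e v)) (Mf v).

Let moving0 v : vertex Q v -> forall t, -1 <= t <= 1 ->
  corner (layer A c 0 t) (v + t *: zmx R (0 : 'cV[int]_n)) (Mf v).
Proof.
move=> vv t _; rewrite layer_const zmx0 scaler0 addr0.
have := moving vv (t := 0); rewrite (layer0 fdQ) scale0r addr0; apply.
by apply/andP; split; lra.
Qed.

(** Both vertices maximize u on the layers at heights 0 and 1. *)
Lemma slope_unique v w u : vertex Q v -> vertex Q w ->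
    normal_cone Q [set v] u -> normal_cone Q [set w] u ->
  dot u (zmx R (e v)) = dot u (zmx R (e w)).
Proof.
move=> vv vw uv uw; have t1 : -1 <= (1 : R) <= 1 by apply/andP; split; lra.
have le1 := layer_max fdQ moving vv uv t1 (corner_in (moving vw t1)).
have le2 := layer_max fdQ moving vw uw t1 (corner_in (moving vv t1)).
have := (normal_cone1 u (vertex_in vv)).1 uv _ (vertex_in vw).
have := (normal_cone1 u (vertex_in vw)).1 uw _ (vertex_in vv).
move: le1 le2; rewrite !dotDr !dotZr !mul1r; lra.
Qed.

Lemma prism_neq0 : prism R A c b !=set0.
Proof.
have [v vv _] := polytope_max 0 pQ nQ; exists (moving_point e (0, v)).
by apply: (prism_in moving) => //; apply/andP; split; lra.
Qed.

(** The product is the prism for b = 0.  Shearing the functionals by the slope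
    of their maximum over the layers turns the description of the faces of one
    prism into that of the other. *)
Lemma prism_comb_equiv : comb_equiv (prism R A c b) (prod_set (segment11 R) Q).
Proof.
rewrite -prism_const.
have /choice [vm hvm] : forall u, exists v,
  vertex Q v /\ normal_cone Q [set v] u.
  move=> u; have [v vv uv] := polytope_max u pQ nQ; exists v; split=> //.
  exact/face_normal_cone1.
pose slope u := dot u (zmx R (e (vm u))).
have slopeE v u : vertex Q v -> normal_cone Q [set v] u ->
    dot u (zmx R (e v)) = slope u.
  by move=> vv uv; have [vw uw] := hvm u; apply: slope_unique.
pose shift s (g : 'cV[R]_(1 + n)) : 'cV[R]_(1 + n) :=
  col_mx (const_mx (usubmx g 0 0 + s * slope (dsubmx g))) (dsubmx g).
have fE g i : signed_vertex Q i -> face (prism R A c b) g (moving_point e i) <->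
    normal_cone Q [set i.2] (dsubmx g) /\
    0 <= i.1 * (usubmx g 0 0 + slope (dsubmx g)).
  move=> ix; rewrite (face_prism fdQ moving) //.
  by split=> -[uv]; rewrite slopeE //; case: ix.
have f0E g i : signed_vertex Q i ->
    face (prism R A c 0) g (moving_point (fun=> 0) i) <->
    normal_cone Q [set i.2] (dsubmx g) /\ 0 <= i.1 * usubmx g 0 0.
  by move=> ix; rewrite (face_prism fdQ moving0) // zmx0 dot0r addr0.
apply: (@comb_equiv_of_vertices _ _ _ _ _ _ (signed_vertex Q) (moving_point e)
  (moving_point (fun=> 0)) (shift 1) (shift (-1))).
- exact: (prism_polytope smQ fdQ).
- exact: (prism_polytope smQ fdQ).
- exact: prism_neq0.
- have [v vv _] := polytope_max 0 pQ nQ; exists (moving_point (fun=> 0) (0, v)).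
  by apply: (prism_in moving0) => //; apply/andP; split; lra.
- by move=> w; apply: (prism_vertex smQ fdQ moving).
- by move=> w; apply: (prism_vertex smQ fdQ moving0).
- move=> g i ix; rewrite fE // f0E // /shift col_mxKu col_mxKd.
  by rewrite [const_mx _ _ _]mxE mul1r.
move=> g i ix; rewrite fE // f0E // /shift col_mxKu col_mxKd.
by rewrite [const_mx _ _ _]mxE mulN1r subrK.
Qed.

Definition fibre_mx : 'M[R]_(1 + n, n) := col_mx 0 1%:M.

Lemma fibre_mxE (y : 'cV[R]_n) : fibre_mx *m y = col_mx 0 y.
Proof. by rewrite mul_col_mx mul0mx mul1mx. Qed.

(** The coordinate changes are trivial; the fibres are layers, which are
    normally isomorphic to Q as their vertex cones agree. *)
Lemma prism_bundle :
  bundle (prism R A c b) (segment11 R) Q (mulmx fibre_mx) (@usubmx R 1 n 1).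
Proof.
have L1 : row_mx 0 1%:M *m fibre_mx = 1%:M.
  by rewrite mul_row_col mul0mx add0r mul1mx.
have img : (@usubmx R 1 n 1) @` prism R A c b = segment11 R.
  apply/seteqP; split=> [_ [z [sz _] <-]//|x sx].
  have [v vv _] := polytope_max 0 pQ nQ; exists (moving_point e (x 0 0, v)).
    exact: (prism_in moving).
  by rewrite /moving_point col_mxKu; apply/colP => i; rewrite mxE ord1.
have fib x : segment11 R x ->
    (@usubmx R 1 n 1) @^-1` [set x] `&` prism R A c b =
    emb fibre_mx (col_mx x 0) (layer A c b (x 0 0)).
  move=> sx; rewrite -(prism_slice A c b sx); apply/seteqP.
  split=> [z [/= zx Pz]|_ [y Sy <-]].
    exists (dsubmx z); rewrite /slice /= -?zx ?vsubmxK //.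
    by rewrite fibre_mxE add_col_mx addr0 add0r vsubmxK.
  by rewrite fibre_mxE add_col_mx addr0 add0r; split=> //=; rewrite col_mxKu.
have fibQ : mulmx fibre_mx @` Q = emb fibre_mx 0 Q.
  by apply/seteqP; split=> _ [y Qy <-]; exists y; rewrite ?add0r.
have p0 : polytope (segment11 R).
  split.
    exists 2%N, (\matrix_(i, j) (if i == 0 then 1 else -1)), (const_mx 1).
    apply/seteqP; split=> x.
      move=> /andP [x1 x2] i; rewrite !mxE big_ord1 mxE.
      by case: ifP => _; rewrite ?mul1r ?mulN1r //; lra.
    move=> h; have := h 0; have := h 1; rewrite !mxE !big_ord1 !mxE /= => h1 h2.
    by apply/andP; split; lra.
  by exists 1 => x sx i; rewrite ord1 ler_norml.
split.
- exact: (prism_polytope smQ fdQ).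
- exact: p0.
- exact: pQ.
- exact: prism_comb_equiv.
- split=> [x y /=|x|z].
  + by rewrite !fibre_mxE => /eq_col_mx [].
  + by exists (col_mx x 0); rewrite /= col_mxKu.
  split=> [/= z0|[y ->]]; last by rewrite /= fibre_mxE col_mxKu.
  by exists (dsubmx z); rewrite fibre_mxE -z0 vsubmxK.
- exists 1%:M, 1%:M, 1%:M; split; first by rewrite !unitmx1.
    by move=> y; rewrite !zmx1 !mul1mx /= fibre_mxE.
  by move=> z; rewrite !zmx1 !mul1mx.
- exact: img.
- move=> x sx; rewrite fib // fibQ; apply/(normally_isomorphic_emb L1).
  have pL : polytope (layer A c b (x 0 0)) by apply:
      (polyhedron_polytope smQ fdQ).
  apply/normally_isomorphicP => //;
    last exact: (layer_vertex_cones smQ fdQ moving).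
  have [v vv _] := polytope_max 0 pQ nQ.
  by exists (v + x 0 0 *: zmx R (e v)); apply: corner_in (moving vv _).
move=> s0; rewrite fib // fibQ mxE (layer0 fdQ) col_mx0 //.
Qed.

End PrismBundle.

(** A point of the Ewald set at height -1 is replaced by its opposite. *)
Lemma escape_neat (R : realType) (n : nat) (Q : set 'cV[R]_n) :
    lattice_smooth Q ->
    (forall (P : set 'cV[R]_(1 + n)) (i : {linear 'cV[R]_n -> 'cV[R]_(1 + n)})
        (p : {linear 'cV[R]_(1 + n) -> 'cV[R]_1}),
      lattice_smooth P -> bundle P (segment11 R) Q i p ->
      ~ (ewald P `<=` i @` Q)) ->
  neat Q.
Proof.
move=> smQ esc; have [m [A [c fdQ]]] := exists_facet_description smQ.
exists m, A, c; split=> // Q_ b nib niN; rewrite /Q_ in nib niN *.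
have [pQ nQ cornQ] := (lattice_smoothP Q).1 smQ.
have pick v : exists Me : 'M[int]_n * 'cV[int]_n, vertex Q v ->
    forall t, -1 <= t <= 1 -> corner (layer A c b t) (v + t *: zmx R Me.2) Me.1.
  have [vv|nv] := pselect (vertex Q v); last by exists (0, 0).
  have [_ [M cM]] := cornQ v vv.
  by have [e he] := moving_corner smQ fdQ vv cM nib niN; exists (M, e).
have [Me hMe] := choice pick.
have moving v (vv : vertex Q v) t (t1 : -1 <= t <= 1) := hMe v vv t t1.
have smP := prism_lattice_smooth smQ fdQ moving.
have /existsNP [z /not_implyP [[[zz zE] Pz PNz] nz]] :=
  esc _ _ _ smP (prism_bundle smQ fdQ moving).
have [s1 L1] := Pz; have [s2 L2] := PNz.
pose k := usubmx zz 0 0.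
have kE : usubmx z 0 0 = k%:~R by rewrite zE /k [LHS]mxE [LHS]mxE [in RHS]mxE.
have lat : lattice (dsubmx z).
  by exists (dsubmx zz); apply/colP => i; rewrite zE !mxE.
have kN : usubmx (- z) 0 0 = - k%:~R by rewrite -kE !mxE.
have dN : dsubmx (- z) = - dsubmx z by apply/colP => i; rewrite !mxE.
rewrite kE in L1; rewrite kN dN in L2.
have k1 : -1 <= k <= 1.
  move: s1; rewrite /segment11 /= kE => /andP [h1 h2].
  by apply/andP; split; rewrite -(ler_int R) ?mulrNz.
have plus x : layer A c b 1 x -> polyhedron (zmx R A) (zmx R (c + b)) x.
  by rewrite /layer scale1r zmxD.
have minus x : layer A c b (-1) x -> polyhedron (zmx R A) (zmx R (c + - b)) x.
  by rewrite /layer scaleN1r zmxD zmxN.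
have [k0|kn1|k1'] : [\/ k = 0, k = -1 | k = 1].
  move: k1; case: (k) => [[|[|i]]|[|i]] // _;
    by [apply: Or31|apply: Or32|apply: Or33].
- case: nz; exists (dsubmx z).
    by move: L1; rewrite k0 (layer0 fdQ).
  rewrite /= fibre_mxE -[RHS]vsubmxK; congr col_mx; apply/colP => i.
  by rewrite ord1 kE k0 mxE.
- exists (- dsubmx z); rewrite opprK; split.
  + by apply: plus; move: L2; rewrite kn1 rmorphN opprK.
  + by apply: minus; move: L1; rewrite kn1 rmorphN.
  by case: lat => y ->; exists (- y); rewrite zmxN.
exists (dsubmx z); split=> //.
+ by apply: plus; move: L1; rewrite k1'.
by apply: minus; move: L2; rewrite k1'.
Qed.

(** * The equivalence *)

Theorem theorem5p9 (R : realType) (n : nat) (Q : set 'cV[R]_n)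
    (hQ : lattice_smooth Q) :
  let cond1 :=
    forall (P : set 'cV[R]_(1 + n))
           (i : {linear 'cV[R]_n -> 'cV[R]_(1 + n)})
           (p : {linear 'cV[R]_(1 + n) -> 'cV[R]_1}),
      lattice_smooth P -> bundle P (segment11 R) Q i p ->
      ~ (ewald P `<=` i @` Q) in
  let cond3 :=
    forall (k : nat) (P : set 'cV[R]_(k + n)) (B : set 'cV[R]_k)
           (i : {linear 'cV[R]_n -> 'cV[R]_(k + n)})
           (p : {linear 'cV[R]_(k + n) -> 'cV[R]_k}),
      lattice_smooth P -> bundle P B Q i p ->
      forall v, ewald B v -> exists2 z, ewald P z & p z = v in
  (cond1 <-> neat Q) /\ (neat Q <-> cond3).
Proof.
move=> cond1 cond3.
have neat_cond3 : neat Q -> cond3.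
  by move=> nQ k P B i p sP bP; apply: (neat_lift hQ nQ sP bP).
have cond3_cond1 : cond3 -> cond1.
  move=> lift P i p sP bP sub.
  have one : ewald (segment11 R) (const_mx 1).
    split; last first.
    - by rewrite /segment11 /= !mxE; apply/andP; split; lra.
    - by rewrite /segment11 /= !mxE; apply/andP; split; lra.
    by exists (const_mx 1); apply/colP => i0; rewrite !mxE.
  have [z /sub [y _ <-] zE] := lift 1%N P _ i p sP bP _ one.
  have [_ _ ex] := bundle_exact bP.
  have : p (i y) = 0 by apply/ex; exists y.
  rewrite zE => /colP /(_ 0); rewrite !mxE => /eqP.
  by rewrite oner_eq0.
have cond1_neat : cond1 -> neat Q by apply: escape_neat.
split; split=> // h.
- by apply/cond3_cond1/neat_cond3.
by apply/cond1_neat/cond3_cond1.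
Qed.
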